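(* Let $r$ be a positive integer, let $\gamma$ be an $r$-core, and let $\mathbf{RH}(\gamma)$ be the set of partitions $\lambda$ with $\gamma\le_r\lambda$. Then for any $m,n\in\mathbb{N}$ there exists a bijection between on one side the $m\times n$ matrices $A=(A_{i,j})_{0\le i<m,\,0\le j<n}$ with entries in $\mathbb{N}^r$, and on the other side the pairs $(P,Q)$ of semistandard $r$-ribbon tableaux of equal shape $\lambda/\gamma$ for some $\lambda\in\mathbf{RH}(\gamma)$ ($P$ having $n$ steps and $Q$ having $m$ steps), such that whenever $A$ corresponds to $(P,Q)$ one has $$\mathrm{wt}(P)=\Bigl(\sum_{i=0}^{m-1}|A_{i,j}|\Bigr)_{0\le j<n},\qquad \mathrm{wt}(Q)=\Bigl(\sum_{j=0}^{n-1}|A_{i,j}|\Bigr)_{0\le i<m},$$ $$\mathrm{spin}(P)+\mathrm{spin}(Q)=\sum_{i=0}^{m-1}\sum_{j=0}^{n-1}\mathrm{n}(A_{i,j}).$$ Moreover the correspondence (the family of these bijections, for all $m,n$) is symmetric: if $A$ is mapped to $(P,Q)$, then the transpose matrix $A^{\mathrm t}$ is mapped to $(Q,P)$.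
   Context: $\mathbb{N}=\{0,1,2,\dots\}$. For $a=(a_0,\dots,a_{r-1})\in\mathbb{N}^r$ put $|a|=\sum_{i=0}^{r-1}a_i$ and $\mathrm{n}(a)=\sum_{i=0}^{r-1}i\,a_i$. Partitions are identified with their Young diagrams (square $(i,j)$ in row $i$, column $j$, both numbered from $0$; rows numbered downwards). Diagonal $d_k$ is $\{(i,j):j-i=k\}$. For partitions $\lambda\subset\mu$, $\mu/\lambda$ is an $r$-ribbon (written $\lambda\prec_r\mu$) if the skew diagram consists of exactly one square on each of $r$ consecutive diagonals; its head is its top-rightmost square, and its height is one less than the number of rows it meets. $\le_r$ is the reflexive transitive closure of $\prec_r$; an $r$-core is a minimal element for $\le_r$ (a partition from which no $r$-ribbon can be removed). The sets $\mathbf{RH}(\gamma)$ are the connected components of the poset of partitions ordered by $\le_r$. $\mu/\lambda$ is a horizontal $r$-ribbon strip, written $\lambda\leftharpoondown_r\mu$, if there is a (possibly trivial) chain $\lambda=\lambda^{(0)}\prec_r\lambda^{(1)}\prec_r\cdots\prec_r\lambda^{(p)}=\mu$ such that, with $d_{k_t}$ the diagonal containing the head of $\lambda^{(t)}/\lambda^{(t-1)}$, one has $k_1<k_2<\cdots<k_p$. The chain is then unique and called the standardisation of $\mu/\lambda$; put $|\mu/\lambda|_r=p$, and $\mathrm{spin}(\mu/\lambda)=\frac12\sum_{t=1}^p\mathrm{ht}(\lambda^{(t)}/\lambda^{(t-1)})$, where $\mathrm{ht}$ is the height. A semistandard $r$-ribbon tableau of shape $\lambda/\gamma$ with $n$ steps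 is a sequence $P=(\gamma=\lambda^0\leftharpoondown_r\lambda^1\leftharpoondown_r\cdots\leftharpoondown_r\lambda^n=\lambda)$ (repetitions allowed); $\mathrm{wt}(P)=(|\lambda^{j+1}/\lambda^j|_r)_{0\le j<n}$ and $\mathrm{spin}(P)=\sum_{j=0}^{n-1}\mathrm{spin}(\lambda^{j+1}/\lambda^j)$. *)

(* Defs.v *)
From HB Require Import structures.
From Stdlib Require Import Relation_Operators.
From mathcomp Require Export all_boot all_order all_algebra.
From mathcomp Require Export boolp classical_sets functions.

Set Implicit Arguments.
Unset Strict Implicit.
Unset Printing Implicit Defensive.

Import Order.TTheory GRing.Theory Num.Theory.

Record intpart := IntPart {
  parts :> seq nat;
  intpartP : sorted geq parts && (0 \notin parts)
}.

HB.instance Definition _ := [isSub for parts].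
HB.instance Definition _ := [Choice of intpart by <:].

(* A square (i, j) lies in row i (numbered downwards) and column j, both
   numbered from 0. *)
Definition diagram (l : intpart) : seq (nat * nat) :=
  [seq (i, j) | i <- iota 0 (size l), j <- iota 0 (nth 0 l i)].

Definition skew (l mu : intpart) : seq (nat * nat) :=
  [seq s <- diagram mu | s \notin diagram l].

Definition diagonal (s : nat * nat) : int := (s.2%:Z - s.1%:Z)%R.

(* mu / l is an r-ribbon: the list of the diagonals of its squares is, up to
   order and with multiplicities, k, k + 1, ..., k + r - 1 for some k. *)
Definition ribbon (r : nat) (l mu : intpart) : Prop :=
  {subset diagram l <= diagram mu} /\
  exists k : int,
    perm_eq [seq diagonal s | s <- skew l mu] [seq (k + i%:Z)%R | i <- iota 0 r].

(* The square of mu / l that is both topmost and rightmost; such a square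
   exists in a nonempty ribbon, and (0, 0) is a dummy value otherwise. *)
Definition ribbon_head (l mu : intpart) : nat * nat :=
  head (0, 0) [seq s <- skew l mu |
                all (fun t => (s.1 <= t.1) && (t.2 <= s.2)) (skew l mu)].

Definition ribbon_height (l mu : intpart) : nat :=
  (size (undup [seq s.1 | s <- skew l mu])).-1.

Definition ribbon_le (r : nat) : intpart -> intpart -> Prop :=
  clos_refl_trans intpart (ribbon r).

Definition core (r : nat) (g : intpart) : Prop :=
  forall l, ribbon_le r l g -> l = g.

Definition RH (r : nat) (g : intpart) : set intpart :=
  [set l | ribbon_le r g l].

(* The chain l = l^(0), l^(1), ..., l^(p) = mu is given by l and the list
   c = [:: l^(1); ...; l^(p)]. *)
Definition is_standardisation (r : nat) (l mu : intpart)
    (c : seq intpart) : Prop :=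
  [/\ path (fun x y => `[< ribbon r x y >]) l c,
      last l c = mu &
      sorted <%R (pairmap (fun x y => diagonal (ribbon_head x y)) l c)].

Definition horizontal_strip (r : nat) (l mu : intpart) : Prop :=
  exists c, is_standardisation r l mu c.

(* When mu / l is a horizontal r-ribbon strip its standardisation is unique, so
   the choice below is immaterial; [::] is a dummy value otherwise. *)
Definition standardisation (r : nat) (l mu : intpart) : seq intpart :=
  xget [::] [set c | is_standardisation r l mu c].

Definition strip_size (r : nat) (l mu : intpart) : nat :=
  size (standardisation r l mu).

Definition strip_spin (r : nat) (l mu : intpart) : rat :=
  ((sumn (pairmap ribbon_height l (standardisation r l mu)))%:R / 2)%R.

Section Tableaux.
Variables (r n : nat).
Implicit Type P : n.+1.-tuple intpart.

Definition before P (j : 'I_n) : intpart := tnth P (widen_ord (leqnSn n) j).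
Definition after P (j : 'I_n) : intpart := tnth P (lift ord0 j).

Definition ribbon_tableau (g l : intpart) P : Prop :=
  [/\ tnth P ord0 = g, tnth P ord_max = l &
      forall j, horizontal_strip r (before P j) (after P j)].

Definition wt P : {ffun 'I_n -> nat} :=
  [ffun j => strip_size r (before P j) (after P j)].

Definition spin P : rat :=
  (\sum_(j < n) strip_spin r (before P j) (after P j))%R.

End Tableaux.

Definition tableau_pairs (r : nat) (g : intpart) (m n : nat) :
    set (n.+1.-tuple intpart * m.+1.-tuple intpart) :=
  [set PQ | exists l, [/\ RH r g l, ribbon_tableau r g l PQ.1 &
                          ribbon_tableau r g l PQ.2]].

Arguments tableau_pairs : clear implicits.

Definition vsum (r : nat) (a : {ffun 'I_r -> nat}) : nat := \sum_(i < r) a i.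

Definition vn (r : nat) (a : {ffun 'I_r -> nat}) : nat := \sum_(i < r) i * a i.

(* Main.v *)
(** A partition is encoded by its beads, the integers l_i - i - 1, so that adding an r-ribbon moves
    a bead from p to an empty place p + r, and a horizontal r-ribbon strip is a finite set f of
    moves made from left to right. The bijection is built cell by cell in a growth diagram. A cell
    (lam, mu, nu, kap) with two strips from lam to mu and nu is transformed into two strips from mu
    and nu to kap by a sweep of p through the integers: at p an involution exchanges the bead at p
    with the hole at p + r in the shape and complements the membership of p in both strips,
    provided that one of them moves p or that the counter of index N is positive, where N is the
    number of beads strictly between p and p + r. When the two memberships of p agree they are
    traded against one unit of that counter. The two heights concerned are both N, so the total
    spin, increased by the sum of i times the i-th counter, does not change. At one end of the
    sweep the counters are an arbitrary vector of N^r, at the other end they all vanish. *)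

Require Import Defs.
From Stdlib Require Import Relation_Operators.
From mathcomp Require Import finmap zify lra.

Set Implicit Arguments.
Unset Strict Implicit.
Unset Printing Implicit Defensive.

Import Order.TTheory GRing.Theory Num.Theory.
Implicit Types (l m : intpart) (k p q x y : int) (f : {fset int}).

(** * Partitions as sequences of beads *)

(** [P] holds on an initial segment, whose length is the count. Bead counts, and the rows rebuilt
    from them, are compared with an index in this way. *)
Lemma ltn_count_iota (P : pred nat) n i :
    (forall i j, i <= j -> P j -> P i) -> (forall i, P i -> i < n) ->
  (i < count P (iota 0 n)) = P i.
Proof.
move=> Pdown Pn.
(* With the bound [i < n] inside the conclusion, the claim no longer assumes that [P] stays below
   [n], so induction on [n] goes through. *)
suff {Pn} : (i < count P (iota 0 n)) = P i && (i < n).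
  by move=> ->; case: (boolP (P i)) => // /Pn ->.
elim: n i => [|n IH] i; first by rewrite andbF.
have -> : iota 0 n.+1 = rcons (iota 0 n) n by rewrite -cats1 -addn1 iotaD.
rewrite -cats1 count_cat /= addn0.
case: (boolP (P n)) => Pn; last first.
  rewrite addn0 IH; case: (boolP (P i)) => //= Pi.
  by have: i != n by [apply: contraTneq Pi => ->]; lia.
have -> : count P (iota 0 n) = n.
  rewrite -[RHS](size_iota 0 n); apply/eqP; rewrite -all_count.
  by apply/allP => k; rewrite mem_iota => kn; apply: Pdown Pn; lia.
case: (leqP i n) => ni; last lia.
by rewrite (Pdown i n) //; lia.
Qed.

Definition part l i : nat := nth 0 l i.

Lemma part_geq l i j : i <= j -> part l j <= part l i.
Proof.
move=> ij; rewrite /part; have [jl|] := ltnP j (size l); last by move/(nth_default 0) => ->.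
have /andP[ls _] := intpartP l.
have geq_trans : transitive geq by move=> a b c /=; lia.
have geq_refl : reflexive geq by move=> a /=.
by apply: (sorted_leq_nth geq_trans geq_refl 0 ls) => //; rewrite inE; lia.
Qed.

Lemma part_gt0 l i : (0 < part l i) = (i < size l).
Proof.
rewrite /part.
have [il|] := ltnP i (size l); last by move/(nth_default 0) => ->.
have /andP[_] := intpartP l; rewrite lt0n; apply: contraNneq => <-.
exact: mem_nth.
Qed.

(* A partition l is encoded by its set of beads, the integers l_i - i - 1;
   [nbeads l k] counts the beads at k or above. *)
Definition nbeads (l : intpart) (k : int) : nat :=
  count (fun i => k < (part l i)%:Z - i%:Z)%R (iota 0 (size l + `|k|)).

(** Presence of a bead at [k]; read along all [k], this is the boundary word of the diagram. *)
Definition edge (l : intpart) (k : int) : bool := nbeads l (k + 1) < nbeads l k.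

Lemma ltn_nbeads l k i : (i < nbeads l k) = (k < (part l i)%:Z - i%:Z)%R.
Proof.
apply: (@ltn_count_iota (fun i => k < (part l i)%:Z - i%:Z)%R).
  by move=> {}i j ij; have := part_geq l ij; lia.
by move=> {}i; have := part_gt0 l i; lia.
Qed.

Lemma nbeads_bounds l k : nbeads l (k + 1) <= nbeads l k <= (nbeads l (k + 1)).+1.
Proof.
apply/andP; split.
  rewrite leqNgt; apply/negP => h; have := ltn_nbeads l (k + 1) (nbeads l k).
  by rewrite h; have := ltn_nbeads l k (nbeads l k); rewrite ltnn; lia.
rewrite leqNgt; apply/negP => h; have := ltn_nbeads l k (nbeads l (k + 1)).+1.
rewrite h; have := ltn_nbeads l (k + 1) (nbeads l (k + 1)); rewrite ltnn.
by have := part_geq l (leqnSn (nbeads l (k + 1))); lia.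
Qed.

Lemma nbeadsS l k : nbeads l k = nbeads l (k + 1) + edge l k.
Proof. by rewrite /edge; have := nbeads_bounds l k; lia. Qed.

Lemma nbeads_gt l k : ((part l 0)%:Z <= k)%R -> nbeads l k = 0.
Proof. by move=> h; have := ltn_nbeads l k 0; lia. Qed.

Lemma nbeads_le l k : (k <= - (size l)%:Z)%R -> nbeads l k = `|k|%N.
Proof.
move=> h; apply/eqP; rewrite eqn_leq; apply/andP; split.
  rewrite leqNgt ltn_nbeads; have := part_gt0 l `|k|; lia.
case E : `|k|%N => [//|n]; rewrite ltn_nbeads; lia.
Qed.

Lemma nbeads_geN l k : (- k <= (nbeads l k)%:Z)%R.
Proof. by have := ltn_nbeads l k (nbeads l k); rewrite ltnn; lia. Qed.

Lemma nbeads_inj l m : nbeads l =1 nbeads m -> l = m.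
Proof.
move=> h; have e i : part l i = part m i.
  apply/eqP; rewrite eqn_leq; apply/andP; split.
    rewrite leqNgt; apply/negP => lt.
    have := ltn_nbeads l ((part m i)%:Z - i%:Z) i.
    by rewrite h ltn_nbeads; lia.
  rewrite leqNgt; apply/negP => lt.
  have := ltn_nbeads l ((part l i)%:Z - i%:Z) i.
  by rewrite h ltn_nbeads; lia.
apply: val_inj; apply: (@eq_from_nth _ 0) => [|i _]; last exact: e.
have := part_gt0 l (size m); have := part_gt0 m (size l).
have := part_gt0 l (size l); have := part_gt0 m (size m).
by rewrite !e /=; lia.
Qed.

Lemma edge_inj l m : edge l =1 edge m -> l = m.
Proof.
move=> h; apply: nbeads_inj => k.
(* Descending induction, started to the right of all beads of both partitions. *)
have [n hn] : {n : nat | ((part l 0)%:Z <= k + n%:Z /\ (part m 0)%:Z <= k + n%:Z)%R}.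
  by exists (part l 0 + part m 0 + `|k|); lia.
elim: n k hn => [|n IH] k [hl hm].
  by rewrite !nbeads_gt //; lia.
by rewrite nbeadsS h IH -?nbeadsS //; lia.
Qed.

Lemma edge_gt l k : ((part l 0)%:Z <= k)%R -> edge l k = false.
Proof. by move=> h; rewrite /edge [nbeads l k]nbeads_gt. Qed.

Lemma edge_lt l k : (k < - (size l)%:Z)%R -> edge l k.
Proof. by move=> h; rewrite /edge !nbeads_le; lia. Qed.

(** The square (i, j) has to lie in the diagram exactly when [i < b (j - i)]; this determines the
    length of every row. *)
Lemma nbeads_realize (b : int -> nat) (a c : int) :
    (forall k : int, b (k + 1)%R <= b k <= (b (k + 1)%R).+1) ->
    (forall k : int, (c <= k)%R -> b k = 0) -> (forall k : int, (k <= a)%R -> b k = `|k|%N) ->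
  {l | nbeads l =1 b}.
Proof.
move=> bb bc ba.
have bd (k : int) (n : nat) : b (k + n%:Z)%R <= b k <= b (k + n%:Z)%R + n.
  elim: n => [|n IH]; first by rewrite addr0 addn0 leqnn.
  have -> : (k + n.+1%:Z = k + n%:Z + 1)%R by lia.
  by have := bb (k + n%:Z)%R; lia.
have bN (k : int) : (- k <= (b k)%:Z)%R.
  have := bd (k - (`|k| + `|a|)%:Z)%R (`|k| + `|a|).
  have := ba (k - (`|k| + `|a|)%:Z)%R.
  have -> : (k - (`|k| + `|a|)%N%:Z + (`|k| + `|a|)%N%:Z = k)%R by lia. lia.
pose row i := count (fun j => i < b (j%:Z - i%:Z)%R) (iota 0 (`|c| + i)).
have rowE i j : (j < row i) = (i < b (j%:Z - i%:Z)%R).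
  apply: (@ltn_count_iota (fun j => i < b (j%:Z - i%:Z)%R)) => [x y xy|x].
    have := bd (x%:Z - i%:Z)%R (y - x).
    have -> : (x%:Z - i%:Z + (y - x)%N%:Z = y%:Z - i%:Z)%R by lia. lia.
  by have := bc (x%:Z - i%:Z)%R; lia.
have row_geq i : row i.+1 <= row i.
  rewrite leqNgt rowE; apply/negP => h.
  have := bb ((row i)%:Z - i.+1%:Z)%R.
  have -> : ((row i)%:Z - i.+1%:Z + 1 = (row i)%:Z - i%:Z)%R by lia.
  by have := rowE i (row i); rewrite ltnn; lia.
pose N := `|a|.
have rowN i : N <= i -> row i = 0.
  by move=> Ni; have := rowE i 0; rewrite sub0r ba; lia.
pose s := [seq x <- mkseq row N | 0 < x].
have srt : sorted geq (mkseq row N).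
  apply/(sortedP 0) => i; rewrite size_mkseq => iN.
  by rewrite !nth_mkseq //=; lia.
have geq_trans : transitive geq by move=> x y z /=; lia.
have ps : sorted geq s && (0 \notin s).
  by rewrite sorted_filter //= mem_filter.
(* The rows decrease weakly, so the filter cuts off a tail of zeros and shifts no index. *)
have nthE i : nth 0 s i = row i.
  have -> : row i = nth 0 (mkseq row N) i.
    have [iN|Ni] := ltnP i N; first by rewrite nth_mkseq.
    by rewrite nth_default ?size_mkseq // rowN.
  rewrite /s; elim: (mkseq row N) srt i => //= x t IH tsrt i.
  case: (posnP x) => [x0|x0]; last first.
    by case: i => //= i; apply: IH; apply: path_sorted tsrt.
  have t0 : all (pred1 0) t.
    have /allP h := order_path_min geq_trans tsrt.
    by apply/allP => y /h /=; lia.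
  have -> : [seq x <- t | 0 < x] = [::].
    apply/eqP; rewrite -[_ == _]negbK -has_filter -all_predC.
    by apply: sub_all t0 => y /=; lia.
  case: i => [|i] /=; rewrite ?x0 //.
  have [it|] := ltnP i (size t); last by move/(nth_default 0) => ->.
  by have /eqP-> := all_nthP 0 t0 i it.
exists (IntPart ps) => k.
have key i : (i < nbeads (IntPart ps) k) = (i < b k).
  rewrite ltn_nbeads /part /= nthE.
  (* If [k + i < 0], the diagonal meets row [i] to the left of column 0; then both sides are true
     because [- k <= b k]. *)
  have [h|h] := leP 0%R (k + i%:Z)%R; last by have := bN k; lia.
  have := rowE i `|(k + i%:Z)%R|%N.
  have -> : ((`|(k + i%:Z)%R|%N)%:Z - i%:Z = k)%R by lia. lia.
have := key (b k); have := key (nbeads (IntPart ps) k); lia.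
Qed.

(** * Ribbons as moves of one bead *)

Lemma mem_diagram l i j : ((i, j) \in diagram l) = (i < nbeads l (diagonal (i, j))).
Proof.
rewrite ltn_nbeads /diagonal /=.
have -> : (j%:Z - i%:Z < (part l i)%:Z - i%:Z)%R = (j < part l i) by lia.
apply/allpairsPdep/idP => [[a [b [ha hb [-> ->]]]]|h].
  by move: hb; rewrite mem_iota.
exists i, j; split => //; rewrite mem_iota //.
by rewrite /= add0n -part_gt0; lia.
Qed.

Lemma diagram_uniq l : uniq (diagram l).
Proof.
apply: allpairs_uniq_dep => [|i _|[i j] [i' j'] _ _ /= [-> ->]] //; exact: iota_uniq.
Qed.

Lemma mem_skew l m s :
  (s \in skew l m) = (nbeads l (diagonal s) <= s.1 < nbeads m (diagonal s)).
Proof. by case: s => i j; rewrite mem_filter !mem_diagram -leqNgt. Qed.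

(** On diagonal [k], the squares of [m] outside [l] occupy the rows from [nbeads l k] to
    [nbeads m k - 1]. *)
Lemma count_diagonal_skew l m k :
  count_mem k [seq diagonal s | s <- skew l m] = nbeads m k - nbeads l k.
Proof.
rewrite count_map -size_filter.
(* The squares are listed by row; the absolute value is just the column [i + k], nonnegative because
   [nbeads l k >= - k]. *)
rewrite -[RHS](size_iota (nbeads l k)) -(size_map (fun i => (i, `|(i%:Z + k)%R|%N))).
apply/perm_size/uniq_perm.
- by rewrite !filter_uniq ?diagram_uniq.
- by rewrite map_inj_uniq ?iota_uniq // => i j [].
move=> [i j]; rewrite mem_filter /= mem_skew /=.
apply/andP/mapP => [[/eqP dk h]|[a]].
  exists i; last by congr pair; move: dk; rewrite /diagonal /=; lia.
  by move: h; rewrite dk mem_iota; lia.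
rewrite mem_iota => h [-> ->]; have := nbeads_geN l k => lk.
have -> : diagonal (a, `|(a%:Z + k)%R|%N) = k by rewrite /diagonal /=; lia.
by split => //; lia.
Qed.

Lemma subset_diagram l m :
  {subset diagram l <= diagram m} <-> forall k, nbeads l k <= nbeads m k.
Proof.
split=> [h k|h [i j]]; last first.
  by rewrite !mem_diagram => /leq_trans; apply; apply: h.
rewrite leqNgt; apply/negP => lt.
(* The first square of diagonal [k] outside [m]. *)
pose i := nbeads m k; have mk := nbeads_geN m k.
have dk : diagonal (i, `|(i%:Z + k)%R|%N) = k by rewrite /diagonal /= /i; lia.
have := h (i, `|(i%:Z + k)%R|%N); rewrite !mem_diagram dk ltnn lt.
by move=> /(_ isT).
Qed.

Lemma count_mem_shift_iota (k x : int) n :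
  count_mem x [seq (k + i%:Z)%R | i <- iota 0 n] = ((k <= x < k + n%:Z)%R : nat).
Proof.
rewrite count_uniq_mem; last by rewrite map_inj_uniq ?iota_uniq // => i j; lia.
congr nat_of_bool; apply/mapP/idP => [[i]|h]; first by rewrite mem_iota; lia.
by exists `|(x - k)%R|%N; rewrite ?mem_iota; lia.
Qed.

(** A bead goes from [p] to [p + r]. This is expressed on counts, whose differences are the numbers
    of squares on the diagonals. *)
Definition moved r p l m := forall x, nbeads m x = nbeads l x + (p < x <= p + r%:Z)%R.

(** By [count_diagonal_skew], one square on each of [r] consecutive diagonals means that the counts
    rise by one there; the first of these diagonals is [p + 1]. *)
Lemma ribbonP r l m : ribbon r l m <-> exists p, moved r p l m.
Proof.
split=> [[/subset_diagram lm [k /allP h]]|[p h]].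
  exists (k - 1)%R => x; have lmx := lm x.
  have cx : count_mem x [seq diagonal s | s <- skew l m]
            = count_mem x [seq (k + i%:Z)%R | i <- iota 0 r].
    have [xi|] := boolP (x \in [seq diagonal s | s <- skew l m] ++
                         [seq (k + i%:Z)%R | i <- iota 0 r]).
      exact/eqP/(h x xi).
    by rewrite mem_cat negb_or => /andP[/count_memPn-> /count_memPn->].
  by move: cx; rewrite count_diagonal_skew count_mem_shift_iota; lia.
split; first by apply/subset_diagram => k; rewrite h leq_addr.
exists (p + 1)%R; apply/allP => x _ /=; apply/eqP.
by rewrite count_diagonal_skew count_mem_shift_iota h; lia.
Qed.

Lemma nbeads_leq l x n : nbeads l (x + n%:Z) <= nbeads l x <= nbeads l (x + n%:Z) + n.
Proof.
elim: n => [|n IH]; first by rewrite addr0 addn0 leqnn.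
have := nbeads_bounds l (x + n%:Z).
have -> : (x + n%:Z + 1 = x + n.+1%:Z)%R by lia. lia.
Qed.

Lemma moved_skew r p l m i j : moved r p l m ->
  ((i, j) \in skew l m) =
  (nbeads l (diagonal (i, j)) == i) && (p < diagonal (i, j) <= p + r%:Z)%R.
Proof. by move=> h; rewrite mem_skew h /=; lia. Qed.

(** The square of the ribbon on diagonal [d] lies in row [nbeads l d]. As [d] increases this row
    index drops by at most one per step, so the ribbon goes only up or right and ends at its
    head. *)
Lemma moved_head r p l m : 0 < r -> moved r p l m ->
  diagonal (ribbon_head l m) = (p + r%:Z)%R.
Proof.
move=> r0 h; rewrite /ribbon_head; set s := filter _ _.
pose i := nbeads l (p + r%:Z).
have ge := nbeads_geN l (p + r%:Z).
pose t := (i, `|(i%:Z + (p + r%:Z))%R|%N).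
have dt : diagonal t = (p + r%:Z)%R by rewrite /diagonal /= /i; lia.
have t_skew : t \in skew l m by rewrite (moved_skew _ _ h) -/t dt /i eqxx; lia.
have t_s : t \in s.
  rewrite mem_filter t_skew andbT; apply/allP => -[a b].
  rewrite (moved_skew _ _ h) => /andP[/eqP ab dab].
  have := nbeads_leq l (diagonal (a, b)) `|(p + r%:Z - diagonal (a, b))%R|%N.
  have -> : (diagonal (a, b) + `|(p + r%:Z - diagonal (a, b))%R|%N%:Z = p + r%:Z)%R by lia.
  by move: dab ab; rewrite /t /i /diagonal /=; lia.
have : head (0, 0) s \in s by case: (s) t_s => //= a b _; rewrite mem_head.
rewrite mem_filter => /andP[/allP/(_ t t_skew)].
case: (head _ _) => a b /=; rewrite (moved_skew _ _ h).
by move: dt; rewrite /diagonal /=; lia.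
Qed.

(** A sequence that decreases by at most one per step takes every value between its last and its
    first. *)
Lemma size_undup_steps (h : nat -> nat) n :
    (forall i, h i.+1 <= h i <= (h i.+1).+1) ->
  size (undup [seq h i | i <- iota 0 n.+1]) = (h 0 - h n).+1.
Proof.
move=> hh; have mono i j : i <= j -> h j <= h i.
  elim: j => [|j IH] ij; first by have -> : i = 0 by lia.
  have [->|ji] := eqVneq i j.+1; first exact: leqnn.
  by have := hh j; have := IH; lia.
rewrite -(size_iota (h n) (h 0 - h n).+1); apply/perm_size/uniq_perm.
- exact: undup_uniq.
- exact: iota_uniq.
move=> y; rewrite mem_undup mem_iota; apply/mapP/idP => [[i]|].
  by rewrite mem_iota => hi ->; have := mono 0 i; have := mono i n; lia.
have := mono 0 n; elim: n => [|n IH] _ hy.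
  by exists 0; rewrite // ; lia.
have := hh n; have := mono 0 n => h0 hn.
have [e|ne] := eqVneq y (h n.+1); first by exists n.+1 => //; rewrite mem_iota; lia.
have hk : h n <= y < h n + (h 0 - h n).+1 by have := h0 (leq0n n); lia.
have [i] := IH h0 hk.
by rewrite mem_iota => hi ->; exists i; rewrite // mem_iota; lia.
Qed.

Definition window r l p : nat := \sum_(i < r.-1) edge l (p + 1 + i%:Z).

Lemma nbeads_sum l x n : nbeads l x = nbeads l (x + n%:Z) + \sum_(i < n) edge l (x + i%:Z).
Proof.
elim: n => [|n IH]; first by rewrite big_ord0 addr0 addn0.
rewrite big_ord_recr /= IH (nbeadsS l (x + n%:Z)) addnA addnAC.
by have -> : (x + n%:Z + 1 = x + n.+1%:Z)%R by lia.
Qed.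

(** The rows met are the values of [nbeads l] on [p + 1], ..., [p + r]; their total drop counts the
    beads strictly between [p] and [p + r]. *)
Lemma moved_height r p l m : 0 < r -> moved r p l m ->
  ribbon_height l m = window r l p.
Proof.
case: r => // r _ h; rewrite /ribbon_height /window /=.
have sE : [seq s.1 | s <- skew l m] =i
          [seq nbeads l (p + 1 + i%:Z) | i <- iota 0 r.+1].
  move=> y; apply/mapP/mapP => [[[a b]]|[i]].
    rewrite (moved_skew _ _ h) => /andP[/eqP ab dab] ->.
    exists `|(diagonal (a, b) - p - 1)%R|%N; first by rewrite mem_iota; lia.
    rewrite -[LHS]ab; congr nbeads; lia.
  rewrite mem_iota => hi ->; set x := (p + 1 + i%:Z)%R.
  have ge := nbeads_geN l x.
  exists (nbeads l x, `|((nbeads l x)%:Z + x)%R|%N) => //.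
  have dx : diagonal (nbeads l x, `|((nbeads l x)%:Z + x)%R|%N) = x.
    by rewrite /diagonal /=; lia.
  by rewrite (moved_skew _ _ h) dx eqxx /= /x; lia.
have /perm_size-> : perm_eq (undup [seq s.1 | s <- skew l m])
          (undup [seq nbeads l (p + 1 + i%:Z) | i <- iota 0 r.+1]).
  by apply: uniq_perm; rewrite ?undup_uniq // => y; rewrite !mem_undup sE.
rewrite size_undup_steps => [|i].
  by rewrite addr0 (nbeads_sum l (p + 1) r) addKn.
have := nbeads_bounds l (p + 1 + i%:Z).
have -> : (p + 1 + i%:Z + 1 = p + 1 + i.+1%:Z)%R by lia. lia.
Qed.

(** * Exchange of a bead with a hole, and horizontal strips as sets of moves *)

Definition toggled r p l x := (edge l x (+) ((x == p) || (x == p + r%:Z)%R))%bool.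

(** [d] is the intended change of the bead counts. Since it vanishes far away on both sides, the new
    counts still have there the values that [nbeads_realize] requires. *)
Lemma edge_realize l (e : int -> bool) (d : int -> int) :
    (forall k, (nbeads l k)%:Z + d k >= 0)%R ->
    (forall k, d k = (d (k + 1) + (e k)%:Z - (edge l k)%:Z))%R ->
    (exists a c : int, forall k, (k < a)%R || (c < k)%R -> d k = 0%R) ->
  exists m, edge m =1 e /\ forall k, ((nbeads m k)%:Z = (nbeads l k)%:Z + d k)%R.
Proof.
move=> dge dS [a [c dac]].
have [|||m hm] := @nbeads_realize (fun k => `|((nbeads l k)%:Z + d k)%R|%N)
  (Num.min (- (size l)%:Z) (a - 1))%R (Num.max ((part l 0)%:Z) (c + 1))%R.
- move=> k; have := dge k; have := dge (k + 1)%R; have := dS k; have := nbeadsS l k.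
  by case: (e k); lia.
- move=> k; rewrite ge_max => /andP[k1 k2]; rewrite nbeads_gt // dac //; lia.
- move=> k; rewrite le_min => /andP[k1 k2]; rewrite nbeads_le // dac //; lia.
exists m; split=> k; last by rewrite hm; have := dge k; lia.
have := nbeadsS m k; rewrite !hm.
have := dge k; have := dge (k + 1)%R; have := dS k; have := nbeadsS l k.
by case: (e k); case: (edge m k); lia.
Qed.

Lemma toggled_realize r p l : 0 < r -> edge l p != edge l (p + r%:Z) ->
  exists m, edge m =1 toggled r p l.
Proof.
(* The counts change only on [p + 1], ..., [p + r]: upwards if the bead leaves [p], downwards if it
   comes from [p + r]. *)
move=> r0 hp; pose s : int := if edge l p then 1%R else (-1)%R.
pose d (k : int) : int := if (p < k <= p + r%:Z)%R then s else 0%R.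
have [|||m []] := @edge_realize l (toggled r p l) d; last by exists m.
- move=> k; rewrite /d /s; case: ifP => [hk|_]; last by lia.
  case: ifP => [_|ep]; first by lia.
  (* The bead at [p + r] is counted at every [k] of the interval, so the count can be lowered by
     one. *)
  have ep' : edge l (p + r%:Z) by move: hp; rewrite ep; case: edge.
  have := nbeads_leq l k `|(p + r%:Z - k)%R|%N.
  have -> : (k + `|(p + r%:Z - k)%R|%N%:Z = p + r%:Z)%R by lia.
  by rewrite (nbeadsS l (p + r%:Z)) ep'; lia.
- move=> k; rewrite /d /toggled.
  have [->|kp] := eqVneq k p.
    by rewrite /s; move: hp; case: (edge l p); case: (edge l (p + r)); do 2 case: ifP; lia.
  have [->|kq] := eqVneq k (p + r%:Z)%R.
    by rewrite /s; move: hp; case: (edge l p); case: (edge l (p + r)); do 2 case: ifP; lia.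
  by rewrite addbF; do 2 case: ifP; lia.
- by exists p, (p + r%:Z)%R => k hk; rewrite /d; case: ifP => //; lia.
Qed.

Definition tog r p l : intpart := xget l [set m | edge m =1 toggled r p l]%classic.

Lemma edge_tog r p l : 0 < r -> edge l p != edge l (p + r%:Z) ->
  edge (tog r p l) =1 toggled r p l.
Proof.
move=> r0 hp; have := toggled_realize r0 hp.
exact: (@xgetPex _ l [set m | edge m =1 toggled r p l]%classic).
Qed.

Lemma togK r p l : 0 < r -> edge l p != edge l (p + r%:Z) -> tog r p (tog r p l) = l.
Proof.
move=> r0 hp; have h := edge_tog r0 hp.
apply: edge_inj => x; rewrite edge_tog // /toggled h /toggled ?addbK //.
by rewrite h /toggled !eqxx orbT; move: hp; do 2 case: edge.
Qed.

Lemma moved_edge r p l m : 0 < r ->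
  moved r p l m <-> [/\ edge l p, ~~ edge l (p + r%:Z) & edge m =1 toggled r p l].
Proof.
move=> r0; split=> [h|[ep eq h] x].
  have e x : (edge m x + (x == p) = edge l x + (x == p + r%:Z)%R)%N.
    have := nbeadsS l x; have := nbeadsS m x; rewrite !h.
    by case: (edge m x); case: (edge l x); lia.
  split; [have := e p|have := e (p + r%:Z)%R|move=> x; have := e x; rewrite /toggled].
  - by case: edge; lia.
  - by case: edge; case: edge; lia.
  - by do 2 case: edge; lia.
have [n xn] : exists n : nat, [/\ (part l 0)%:Z <= x + n%:Z, (part m 0)%:Z <= x + n%:Z
      & p + r%:Z < x + n%:Z]%R.
  by exists (part l 0 + part m 0 + `|x| + `|p| + r).+1; split; lia.
elim: n x xn => [|n IH] x [x1 x2 x3]; first by rewrite !nbeads_gt; lia.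
rewrite nbeadsS [nbeads l x]nbeadsS IH ?h ?/toggled; last by split; lia.
have [->|xp] := eqVneq x p; first by rewrite ep; lia.
have [->|xq] := eqVneq x (p + r%:Z)%R; first by case: edge eq => //; lia.
by rewrite addbF; lia.
Qed.

(* In the strip m / l the beads at the points of f move r steps to the right,
   in increasing order; a bead may enter a place that it leaves later. *)
Definition bead_strip r l (f : {fset int}) m := forall x,
  edge l x + ((x - r%:Z)%R \in f) = edge m x + (x \in f) /\ edge m x + (x \in f) <= 1.

Definition fwindow r (f : {fset int}) p : nat := \sum_(i < r.-1) ((p + 1 + i%:Z)%R \in f).

(** The sum of the heights: when the bead at [y] moves, the beads strictly between [y] and [y + r]
    are those of the final [m] together with those that still have to leave. *)
Definition twice_spin r m (f : {fset int}) : nat :=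
  \sum_(y <- f) (window r m y + fwindow r f y).

Definition heads l (c : seq intpart) :=
  pairmap (fun m m' => diagonal (ribbon_head m m')) l c.

Lemma bead_strip0 r l : bead_strip r l fset0 l.
Proof. by move=> x; rewrite !in_fset0; case: edge. Qed.

Lemma bead_strip_cons r p l l1 m f : 0 < r -> moved r p l l1 ->
    (forall y, y \in f -> p < y)%R -> bead_strip r l1 f m ->
  bead_strip r l (p |` f)%fset m.
Proof.
move=> r0 /(moved_edge _ _ _ r0) [ep eq h1] pf h x.
have := h x; rewrite h1 /toggled !in_fset1U.
have pNf : p \notin f by apply/negP => /pf; lia.
have prNf : (p - r%:Z)%R \notin f by apply/negP => /pf; lia.
have [->|xp] := eqVneq x p.
  rewrite ep (negPf pNf) (negPf prNf).
  by have -> : (p - r%:Z == p)%R = false by [lia]; lia.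
have [->|xq] := eqVneq x (p + r%:Z)%R.
  by rewrite (negPf eq) addrK eqxx (negPf pNf) /=; lia.
have -> : (x - r%:Z == p)%R = false by lia.
by rewrite addbF.
Qed.

Lemma bead_strip_behead r p l l1 m f : 0 < r -> moved r p l l1 ->
    p \in f -> (forall y, y \in f -> p <= y)%R -> bead_strip r l f m ->
  bead_strip r l1 (f `\ p)%fset m.
Proof.
move=> r0 /(moved_edge _ _ _ r0) [ep eq h1] pf pmin h x.
have := h x; rewrite h1 /toggled !in_fsetD1.
have prNf : (p - r%:Z)%R \notin f by apply/negP => /pmin; lia.
have [->|xp] := eqVneq x p.
  by rewrite ep pf (negPf prNf) andbF; lia.
have [->|xq] := eqVneq x (p + r%:Z)%R.
  by rewrite (negPf eq) addrK eqxx pf /=; lia.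
have -> : (x - r%:Z == p)%R = false by lia.
by rewrite addbF.
Qed.

Lemma bead_strip_first r p l m f : 0 < r ->
    p \in f -> (forall y, y \in f -> p <= y)%R -> bead_strip r l f m ->
  moved r p l (tog r p l).
Proof.
move=> r0 pf pmin h.
have prNf : (p - r%:Z)%R \notin f by apply/negP => /pmin; lia.
have [] := h p; have [] := h (p + r%:Z)%R; rewrite addrK pf (negPf prNf).
move=> h1 h2 h3 h4; have ep : edge l p by case: edge h3; lia.
have eq : ~~ edge l (p + r%:Z) by case: edge h1; lia.
by apply/(moved_edge _ _ _ r0); split=> //; apply: edge_tog; rewrite // ep (negPf eq).
Qed.

(** A bead arriving strictly between [p] and [p + r] would come from the left of [p], where [f] has
    no point. *)
Lemma window_first r p l m f : (0 < r) -> (forall y, y \in f -> p <= y)%R ->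
  bead_strip r l f m -> window r l p = window r m p + fwindow r f p.
Proof.
move=> r0 pmin h; rewrite /window /fwindow -big_split; apply: eq_bigr => i _ /=.
have [<- _] := h (p + 1 + i%:Z)%R.
have /negPf-> : (p + 1 + i%:Z - r%:Z)%R \notin f.
  by apply/negP => /pmin; have := ltn_ord i; lia.
by rewrite addn0.
Qed.

(** The first ribbon of the chain moves the leftmost point of [f], because the later heads lie
    further right; the chain is peeled off from its front. *)
Lemma bead_strip_standard r l m c : 0 < r -> is_standardisation r l m c ->
  exists f : {fset int}, [/\ bead_strip r l f m, size c = #|` f|,
    sumn (pairmap ribbon_height l c) = twice_spin r m f &
    forall p, (p \in f) = ((p + r%:Z)%R \in heads l c)].
Proof.
move=> r0; elim: c l => [|l1 c IH] l [/= pc lc sc].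
  exists fset0; split=> //; first by rewrite -lc; exact: bead_strip0.
    by rewrite /twice_spin big_seq_fset0.
move/andP: pc => [/asboolP/ribbonP [p mp] pc].
have [] := IH l1; first by split=> //; exact: path_sorted sc.
move=> f [hf szf spf memf]; have dp := moved_head r0 mp.
have pf y : (y \in f -> p < y)%R.
  have /allP h := order_path_min lt_trans sc.
  by rewrite memf => /h; rewrite dp; lia.
have pNf : p \notin f by apply/negP => /pf; rewrite ltxx.
have hs := bead_strip_cons r0 mp pf hf.
exists (p |` f)%fset; split=> //.
- by rewrite cardfsU1 pNf szf.
- rewrite spf /twice_spin big_fsetU1 //= (moved_height r0 mp).
  rewrite (@window_first r p l m _ r0 _ hs); last first.
    by move=> y; rewrite in_fset1U => /orP[/eqP->//|/pf/ltW].
  congr addn; rewrite big_seq [RHS]big_seq; apply: eq_bigr => y /pf py.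
  congr addn; apply: eq_bigr => i _; rewrite in_fset1U.
  by have -> : (y + 1 + i%:Z == p)%R = false by lia.
- move=> y; rewrite in_fset1U memf in_cons dp; congr orb.
  by lia.
Qed.

Lemma standard_bead_strip r l m f : 0 < r -> bead_strip r l f m ->
  exists c, is_standardisation r l m c.
Proof.
move=> r0 h.
(* The heads are recorded as well, since the induction needs them to show that they increase along
   the chain. *)
suff [c []] : exists c, is_standardisation r l m c /\
    forall p, ((p + r%:Z)%R \in heads l c) = (p \in f) by exists c.
have [ps [fps sps]] : exists ps : seq int, f =i ps /\ sorted <%R ps.
  exists (sort <=%R f); split; last by rewrite sort_lt_sorted fset_uniq.
  by move=> x; rewrite mem_sort.
elim: ps l f h fps sps => [|p ps IH] l f h fps sps.
  exists [::]; split; last by move=> p; rewrite fps.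
  split=> //; apply: edge_inj => x.
  by have [] := h x; rewrite !fps /=; do 2 case: edge.
have /allP pmin := order_path_min lt_trans sps.
have pf : p \in f by rewrite fps mem_head.
have pm y : (y \in f -> p <= y)%R.
  by rewrite fps in_cons => /orP[/eqP->//|/pmin/ltW].
have mp := bead_strip_first r0 pf pm h.
have [||c [[pc lc sc] hc]] := IH _ (f `\ p)%fset (bead_strip_behead r0 mp pf pm h).
- move=> y; rewrite in_fsetD1 fps in_cons; case: eqVneq => //= ->.
  by symmetry; apply/negP => /pmin; rewrite ltxx.
- exact: path_sorted sps.
have dp := moved_head r0 mp.
exists (tog r p l :: c); split.
  split=> //=.
    by rewrite pc andbT; apply/asboolP/ribbonP; exists p.
  rewrite dp (path_sortedE lt_trans) sc andbT; apply/allP => y.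
  have -> : y = (y - r%:Z + r%:Z)%R by rewrite subrK.
  by rewrite hc in_fsetD1 => /andP[yp /pm]; lia.
move=> y; rewrite in_cons dp hc in_fsetD1.
have -> : (y + r%:Z == p + r%:Z)%R = (y == p) by lia.
by case: eqVneq => // ->; rewrite pf.
Qed.

Lemma fset_int_bound (f : {fset int}) : {M : nat | forall x, x \in f -> (`|x| <= M%:Z)%R}.
Proof.
exists (\sum_(x <- f) `|x|%N) => x xf; rewrite (big_fsetD1 x) //=; lia.
Qed.

(** The two bead patterns and the membership of [x - r] decide that of [x], and far to the left both
    sets are empty. *)
Lemma bead_strip_uniq r l m f f' : 0 < r ->
  bead_strip r l f m -> bead_strip r l f' m -> f = f'.
Proof.
move=> r0 h h'; have [M hM] := fset_int_bound (f `|` f')%fset.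
suff key (n : nat) x : (x < n%:Z - M%:Z)%R -> (x \in f) = (x \in f').
  by apply/fsetP => x; apply: (key (M + `|x| + 1)); lia.
elim: n x => [|n IH] x xn.
  have := hM x; rewrite in_fsetU.
  by case: (x \in f); case: (x \in f') => //= /(_ isT); lia.
have [] := h x; have [] := h' x; rewrite (IH (x - r%:Z)%R); last lia.
move: ((x - r%:Z)%R \in f') => b.
by case: (x \in f); case: (x \in f'); case: b => //; do 2 case: edge.
Qed.

Lemma horizontal_stripP r l m : 0 < r ->
  horizontal_strip r l m <-> exists f, bead_strip r l f m.
Proof.
move=> r0; split=> [[c /(bead_strip_standard r0) [f []]]|[f]]; first by exists f.
exact: standard_bead_strip.
Qed.

Lemma standardisation_bead_strip r l m f : 0 < r -> bead_strip r l f m ->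
  strip_size r l m = #|` f| /\ strip_spin r l m = ((twice_spin r m f)%:R / 2)%R.
Proof.
move=> r0 h; have [c hc] := standard_bead_strip r0 h.
have hs : is_standardisation r l m (standardisation r l m).
  exact: (@xgetPex _ [::] [set c | is_standardisation r l m c]%classic (ex_intro _ c hc)).
have [f' [h' sz sp _]] := bead_strip_standard r0 hs.
by rewrite (bead_strip_uniq r0 h h') /strip_size /strip_spin sz sp.
Qed.

Lemma standardisation_ribbon_le r l m c :
  is_standardisation r l m c -> ribbon_le r l m.
Proof.
case=> + + _; elim: c l => [|l1 c IH] l /=; first by move=> _ ->; exact: rt_refl.
move=> /andP[/asboolP h pc] lc; apply: rt_trans (IH _ pc lc); exact: rt_step.
Qed.

(** * The involution at one place of the sweep *)

Definition ftog p f : {fset int} := if p \in f then (f `\ p)%fset else (p |` f)%fset.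

Lemma in_ftog p f x : (x \in ftog p f) = (x \in f) (+) (x == p).
Proof.
rewrite /ftog; case: ifP => pf; rewrite ?in_fsetD1 ?in_fset1U;
  by case: eqVneq => [->|]; rewrite ?pf ?addbF.
Qed.

Lemma ftogK p f : ftog p (ftog p f) = f.
Proof. by apply/fsetP => x; rewrite !in_ftog addbK. Qed.

Lemma ftogD1 p f : (ftog p f `\ p = f `\ p)%fset.
Proof.
by apply/fsetP => x; rewrite !in_fsetD1 in_ftog; case: eqVneq => //=; rewrite addbF.
Qed.

Lemma ftogE p f : (p \in ftog p f) = (p \notin f).
Proof. by rewrite in_ftog eqxx addbT. Qed.

(* The moves at the points of f lead up from mu to kap at the places below p,
   and down from mu to kap at the places above p + r. *)
Definition halfway r p mu f kap := forall x,
  if (x < p)%R then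
    edge kap x + (x \in f) = edge mu x + ((x - r%:Z)%R \in f) /\
    edge kap x + (x \in f) <= 1
  else if (x < p + r%:Z)%R then
    edge kap x = edge mu x + (x \in f) + ((x - r%:Z)%R \in f) :> nat
  else
    edge kap x + ((x - r%:Z)%R \in f) = edge mu x + (x \in f) /\
    edge mu x + (x \in f) <= 1.

(** Only [p] and [p + r] change clause, and the two equations differ there just in the side on which
    the membership of [p] is added. *)
Lemma halfway_notin r p mu f kap : 0 < r -> p \notin f ->
  halfway r p mu f kap <-> halfway r (p + 1) mu f kap.
Proof.
move=> r0 pf; split=> h x; have := h x.
  have [->|xp] := eqVneq x p.
    by rewrite (negPf pf); do !case: ifP; case: edge; lia.
  have [->|xq] := eqVneq x (p + r%:Z)%R.
    by rewrite addrK (negPf pf); do !case: ifP; lia.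
  by do !case: ifP; lia.
have [->|xp] := eqVneq x p.
  by rewrite (negPf pf); do !case: ifP; case: edge; lia.
have [->|xq] := eqVneq x (p + r%:Z)%R.
  by rewrite addrK (negPf pf); do !case: ifP; case: edge; lia.
by do !case: ifP; lia.
Qed.

(** Complementing the membership of [p] and moving the bead of [kap] from [p] to [p + r] compensate
    for that change of side. *)
Lemma halfway_flip_up r p mu f kap : 0 < r -> edge kap p -> ~~ edge kap (p + r%:Z) ->
  halfway r p mu f kap -> halfway r (p + 1) mu (ftog p f) (tog r p kap).
Proof.
move=> r0 ep /negPf eq h x; have := h x.
rewrite !in_ftog edge_tog ?ep ?eq // /toggled.
have -> : (x - r%:Z == p)%R = (x == p + r%:Z)%R by lia.
have [->|xp] := eqVneq x p.
  have -> : (p == p + r%:Z)%R = false by lia.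
  by rewrite ep; do !case: ifP; case: (p \in f); case: (_ \in f); case: edge => //=; lia.
have [->|xq] := eqVneq x (p + r%:Z)%R.
  by rewrite eq addrK; do !case: ifP; case: (p \in f); case: (_ \in f); case: edge => //=; lia.
by rewrite /= !addbF; do !case: ifP; lia.
Qed.

Lemma halfway_flip_down r p mu f kap : 0 < r -> ~~ edge kap p -> edge kap (p + r%:Z) ->
  halfway r (p + 1) mu f kap -> halfway r p mu (ftog p f) (tog r p kap).
Proof.
move=> r0 /negPf ep eq h x; have := h x.
rewrite !in_ftog edge_tog ?ep ?eq // /toggled.
have -> : (x - r%:Z == p)%R = (x == p + r%:Z)%R by lia.
have [->|xp] := eqVneq x p.
  have -> : (p == p + r%:Z)%R = false by lia.
  by rewrite ep; do !case: ifP; case: (p \in f); case: (_ \in f); case: edge => //=; lia.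
have [->|xq] := eqVneq x (p + r%:Z)%R.
  by rewrite eq addrK; do !case: ifP; case: (p \in f); case: (_ \in f); case: edge => //=; lia.
by rewrite /= !addbF; do !case: ifP; lia.
Qed.

(** Once the sweep has passed [p], a move at [p] forces a hole of [kap] at [p] and a bead at
    [p + r]; before that it forces the opposite, whence [halfway_notin_up]. *)
Lemma halfway_notin_down r p mu f kap : 0 < r ->
  halfway r (p + 1) mu f kap -> edge kap p || ~~ edge kap (p + r%:Z) -> p \notin f.
Proof.
move=> r0 h; have := h p; have := h (p + r%:Z)%R; rewrite addrK.
by do !case: ifP; case: (p \in f); case: edge; case: edge => //; lia.
Qed.

Lemma halfway_notin_up r p mu f kap : 0 < r ->
  halfway r p mu f kap -> ~~ edge kap p || edge kap (p + r%:Z) -> p \notin f.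
Proof.
move=> r0 h; have := h p; have := h (p + r%:Z)%R; rewrite addrK.
by do !case: ifP; case: (p \in f); case: edge; case: edge => //; lia.
Qed.

(** All places strictly between [p] and [p + r] fall under the middle clause of [halfway]. *)
Lemma halfway_window r p mu f kap : 0 < r -> halfway r p mu f kap ->
  window r kap p = window r mu p + fwindow r f p + fwindow r f (p - r%:Z).
Proof.
move=> r0 h; rewrite /window /fwindow -!big_split; apply: eq_bigr => -[i hi] _ /=.
have := h (p + 1 + i%:Z)%R.
have -> : (p - r%:Z + 1 + i%:Z = p + 1 + i%:Z - r%:Z)%R by lia.
have -> : (p + 1 + i%:Z < p)%R = false by lia.
have -> : (p + 1 + i%:Z < p + r%:Z)%R by lia.
by [].
Qed.

Record state := State {
  shape : intpart; moves1 : {fset int}; moves2 : {fset int}; counts : nat -> nat }.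

Definition flips r p s :=
  (edge (shape s) p != edge (shape s) (p + r%:Z)) &&
  [|| p \in moves1 s, p \in moves2 s | 0 < counts s (window r (shape s) p)].

(** One predecessor covers three cases: two memberships turn into a new unit of the counter, no
    membership uses up a unit, and a single membership passes to the other strip with the counter
    unchanged. *)
Definition flip r p s :=
  if flips r p s then
    State (tog r p (shape s)) (ftog p (moves1 s)) (ftog p (moves2 s))
      (fun i => if i == window r (shape s) p
                then (counts s i + (p \in moves1 s) + (p \in moves2 s)).-1
                else counts s i)
  else s.

Definition beads_from r l p : nat := \sum_(i < r) edge l (p + i%:Z).

(** Counters live only at indices below the number of beads in the window starting at [p]. Far to
    the left this number is [r], so the counters below [r] are free; far to the right it is 0, so
    all of them vanish. *)
Definition stage r mu nu p s := [/\ halfway r p mu (moves1 s) (shape s),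
  halfway r p nu (moves2 s) (shape s) &
  forall i, beads_from r (shape s) p <= i -> counts s i = 0].

Lemma beads_from_window r l p : 0 < r -> beads_from r l p = edge l p + window r l p.
Proof.
case: r => // r _; rewrite /beads_from /window big_ord_recl addr0; congr addn.
apply: eq_bigr => -[i hi] _ /=; congr nat_of_bool; congr edge.
by rewrite /bump /=; lia.
Qed.

Lemma beads_from_windowS r l p : 0 < r ->
  beads_from r l (p + 1) = edge l (p + r%:Z) + window r l p.
Proof.
case: r => // r _; rewrite /beads_from /window big_ord_recr addnC /=; congr addn.
by congr nat_of_bool; congr edge; lia.
Qed.

Lemma window_tog r p l : 0 < r -> edge l p != edge l (p + r%:Z) ->
  window r (tog r p l) p = window r l p.
Proof.
move=> r0 h; apply: eq_bigr => i _; rewrite edge_tog // /toggled.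
have -> : (p + 1 + i%:Z == p)%R = false by lia.
have -> : (p + 1 + i%:Z == p + r%:Z)%R = false by have := ltn_ord i; lia.
by rewrite addbF.
Qed.

Lemma edge_tog_ends r p l : 0 < r -> edge l p != edge l (p + r%:Z) ->
  edge (tog r p l) p = ~~ edge l p /\ edge (tog r p l) (p + r%:Z) = ~~ edge l (p + r%:Z).
Proof. by move=> r0 h; rewrite !edge_tog // /toggled !eqxx orbT !addbT. Qed.

Lemma flip_id r p s : ~~ flips r p s -> flip r p s = s.
Proof. by rewrite /flip => /negPf->. Qed.

(** The exchange leaves the window, hence the index, untouched. After a flip either a membership
    holds or the counter has just been raised, so the condition for flipping holds again. *)
Lemma flipK r p s : 0 < r -> flip r p (flip r p s) = s.
Proof.
move=> r0; have [fl|nfl] := boolP (flips r p s); last by rewrite !flip_id.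
have /andP[ne hc] := fl; have [e1 e2] := edge_tog_ends r0 ne.
have fl' : flips r p (flip r p s).
  rewrite /flip fl /flips /= e1 e2 !ftogE window_tog // eqxx.
  rewrite (can_eq negbK) ne /=.
  by move: hc; case: (p \in moves1 s); case: (p \in moves2 s) => //=; lia.
rewrite {1}/flip fl' {fl'} /flip fl /= togK // !ftogK window_tog //.
case: s {fl e1 e2} ne hc => kap f f' c /= ne hc; congr State.
apply: funext => i; case: eqP => // ->; rewrite !ftogE.
by move: hc; case: (p \in f); case: (p \in f') => //=; lia.
Qed.

Lemma stage_flip_down r mu nu p s : 0 < r ->
  stage r mu nu (p + 1) s -> stage r mu nu p (flip r p s).
Proof.
move=> r0 [h1 h2 hc]; have [/andP[ne hf]|nfl] := boolP (flips r p s).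
  (* With a bead at [p] and a hole at [p + r], the stage at [p + 1] excludes [p] from both strips
     and makes the counter zero, so nothing would flip. *)
  have [ep eq] : ~~ edge (shape s) p /\ edge (shape s) (p + r%:Z).
    suff: ~~ edge (shape s) p by case: edge ne => //; case: edge.
    apply/negP => ep; have eq : edge (shape s) (p + r%:Z) = false.
      by rewrite ep in ne; case: edge ne.
    have := halfway_notin_down r0 h1; have := halfway_notin_down r0 h2; rewrite ep.
    move=> /(_ isT)/negPf e2 /(_ isT)/negPf e1; move: hf.
    by rewrite e1 e2 /= hc // beads_from_windowS // eq.
  rewrite /flip /flips ne hf; split=> /=; try exact: halfway_flip_down.
  move=> i; rewrite beads_from_window // window_tog //.
  have [-> _] := edge_tog_ends r0 ne; rewrite ep => hi.
  by case: eqP => [|_]; [lia|apply: hc; rewrite beads_from_windowS // eq].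
rewrite flip_id //; have [ne|/negPn/eqP ee] := boolP (edge (shape s) p != edge (shape s) (p + r%:Z)).
  move: nfl; rewrite /flips ne /= !negb_or => /and3P[n1 n2 n3].
  split; [exact: (halfway_notin _ _ r0 n1).2|exact: (halfway_notin _ _ r0 n2).2|].
  move=> i; rewrite beads_from_window // => hi.
  have [iN|iN] := eqVneq i (window r (shape s) p); first by rewrite iN; lia.
  by apply: hc; rewrite beads_from_windowS //; case: edge; lia.
have e : edge (shape s) p || ~~ edge (shape s) (p + r%:Z) by rewrite ee orbN.
split.
- exact: (halfway_notin _ _ r0 (halfway_notin_down r0 h1 e)).2.
- exact: (halfway_notin _ _ r0 (halfway_notin_down r0 h2 e)).2.
- by move=> i; rewrite beads_from_window // ee -beads_from_windowS //; apply: hc.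
Qed.

Lemma stage_flip_up r mu nu p s : 0 < r ->
  stage r mu nu p s -> stage r mu nu (p + 1) (flip r p s).
Proof.
move=> r0 [h1 h2 hc]; have [/andP[ne hf]|nfl] := boolP (flips r p s).
  have [ep eq] : edge (shape s) p /\ ~~ edge (shape s) (p + r%:Z).
    suff: edge (shape s) p by case: edge ne => //; case: edge.
    apply/negPn/negP => ep; have eq : edge (shape s) (p + r%:Z).
      by rewrite (negPf ep) in ne; case: edge ne.
    have := halfway_notin_up r0 h1; have := halfway_notin_up r0 h2; rewrite ep.
    move=> /(_ isT)/negPf e2 /(_ isT)/negPf e1; move: hf.
    by rewrite e1 e2 /= hc // beads_from_window // (negPf ep).
  rewrite /flip /flips ne hf; split=> /=; try exact: halfway_flip_up.
  move=> i; rewrite beads_from_windowS // window_tog //.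
  have [_ ->] := edge_tog_ends r0 ne; rewrite eq => hi.
  by case: eqP => [|_]; [lia|apply: hc; rewrite beads_from_window // ep].
rewrite flip_id //; have [ne|/negPn/eqP ee] := boolP (edge (shape s) p != edge (shape s) (p + r%:Z)).
  move: nfl; rewrite /flips ne /= !negb_or => /and3P[n1 n2 n3].
  split; [exact: (halfway_notin _ _ r0 n1).1|exact: (halfway_notin _ _ r0 n2).1|].
  move=> i; rewrite beads_from_windowS // => hi.
  have [iN|iN] := eqVneq i (window r (shape s) p); first by rewrite iN; lia.
  by apply: hc; rewrite beads_from_window //; case: edge; lia.
have e : ~~ edge (shape s) p || edge (shape s) (p + r%:Z) by rewrite ee orNb.
split.
- exact: (halfway_notin _ _ r0 (halfway_notin_up r0 h1 e)).1.
- exact: (halfway_notin _ _ r0 (halfway_notin_up r0 h2 e)).1.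
- by move=> i; rewrite beads_from_windowS // -ee -beads_from_window //; apply: hc.
Qed.

(** If exactly one of [p] and [p + r] carries a bead, one of the two stages excludes [p] from both
    strips and makes the counter zero. Hence the sweep is stationary beyond its two ends. *)
Lemma flip_stages r mu nu p s : 0 < r ->
  stage r mu nu p s -> stage r mu nu (p + 1) s -> flip r p s = s.
Proof.
move=> r0 [h1 h2 hc] [h1' h2' hc']; apply: flip_id; rewrite /flips.
case ep: (edge (shape s) p); case eq: (edge (shape s) (p + r%:Z)) => //=.
  rewrite (negPf (halfway_notin_down r0 h1' _)) ?ep //.
  rewrite (negPf (halfway_notin_down r0 h2' _)) ?ep //.
  by rewrite hc' // beads_from_windowS // eq.
rewrite (negPf (halfway_notin_up r0 h1 _)) ?ep //.
rewrite (negPf (halfway_notin_up r0 h2 _)) ?ep //.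
by rewrite hc // beads_from_window // ep.
Qed.

(** * Invariance of spin and size *)

Lemma sum_eq_mem f x : \sum_(y <- f) (y == x) = (x \in f).
Proof.
transitivity (\sum_(y <- f | y == x) 1).
  by rewrite [RHS]big_mkcond; apply: eq_bigr => y _; case: eqP.
by rewrite sum1_count count_uniq_mem ?fset_uniq.
Qed.

Lemma fwindowE r f y : 0 < r -> fwindow r f y = \sum_(z <- f) (y < z < y + r%:Z)%R.
Proof.
case: r => // r _; rewrite /fwindow /=.
transitivity (\sum_(i < r) \sum_(z <- f) (z == y + 1 + i%:Z)%R).
  by apply: eq_bigr => i _; rewrite sum_eq_mem.
rewrite exchange_big; apply: eq_bigr => z _ /=.
elim: r => [|r IH]; first by rewrite big_ord0; case: ltP => //=; lia.
by rewrite big_ord_recr /= IH; lia.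
Qed.

(** Besides its own term, [p] adds one unit to the term of each [y] in [f] with [y < p < y + r];
    these are counted by [fwindow r f (p - r)]. *)
Lemma twice_spinD1 r mu f p : 0 < r -> p \in f ->
  twice_spin r mu f = twice_spin r mu (f `\ p)%fset +
    (window r mu p + fwindow r f p + fwindow r f (p - r%:Z)).
Proof.
move=> r0 pf; rewrite /twice_spin [LHS](big_fsetD1 p) //=.
have -> : fwindow r f (p - r%:Z) = \sum_(y <- (f `\ p)%fset) (y < p < y + r%:Z)%R.
  rewrite fwindowE // (big_fsetD1 p) //=.
  have -> : (p - r%:Z < p < p - r%:Z + r%:Z)%R = false by lia.
  by rewrite add0n; apply: eq_bigr => y _; lia.
have -> : \sum_(y <- (f `\ p)%fset) (window r mu y + fwindow r f y) =
    \sum_(y <- (f `\ p)%fset) (window r mu y + fwindow r (f `\ p)%fset y) +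
    \sum_(y <- (f `\ p)%fset) (y < p < y + r%:Z)%R.
  rewrite -big_split; apply: eq_bigr => y _ /=.
  by rewrite fwindowE // (big_fsetD1 p) //= -fwindowE //; lia.
set A := \sum_(_ <- _) _; set B := \sum_(_ <- _) _.
by rewrite [LHS]addnCA.
Qed.

(** Both sides count the pairs of distinct points of [f] at distance less than [r], once from the
    right point and once from the left one. *)
Lemma sum_fwindow_sym r f : 0 < r ->
  \sum_(y <- f) fwindow r f (y - r%:Z) = \sum_(y <- f) fwindow r f y.
Proof.
move=> r0; under eq_bigr => y _ do rewrite fwindowE //.
under [RHS]eq_bigr => y _ do rewrite fwindowE //.
rewrite exchange_big; apply: eq_bigr => y _; apply: eq_bigr => z _ /=.
by congr nat_of_bool; lia.
Qed.

(** The bead equation, summed over the windows, trades [fwindow] at [y] for [fwindow] at [y - r].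
    The spin of a strip can thus be computed at either end, which allows [mu] and [nu] to serve
    throughout a sweep. *)
Lemma twice_spin_strip r mu f kap : 0 < r -> bead_strip r mu f kap ->
  twice_spin r kap f = twice_spin r mu f.
Proof.
move=> r0 h; rewrite /twice_spin [RHS]big_split -(sum_fwindow_sym f r0) -big_split.
apply: eq_bigr => y _ /=; rewrite /window /fwindow -!big_split; apply: eq_bigr => i _ /=.
have [<- _] := h (y + 1 + i%:Z)%R; congr (_ + nat_of_bool (_ \in f)).
by lia.
Qed.

Lemma fwindow_ftog r f p : 0 < r -> fwindow r (ftog p f) p = fwindow r f p.
Proof.
move=> r0; apply: eq_bigr => i _; rewrite in_ftog.
by have -> : (p + 1 + i%:Z == p)%R = false by [lia]; rewrite addbF.
Qed.

Lemma fwindow_ftogB r f p : 0 < r ->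
  fwindow r (ftog p f) (p - r%:Z) = fwindow r f (p - r%:Z).
Proof.
move=> r0; apply: eq_bigr => -[i hi] _ /=; rewrite in_ftog.
by have -> : (p - r%:Z + 1 + i%:Z == p)%R = false by [lia]; rewrite addbF.
Qed.

(** The contribution of [p] in [twice_spinD1] is the sum that [halfway_window] identifies with the
    window of [kap]. *)
Lemma twice_spin_ftog r p mu f kap : 0 < r -> halfway r p mu f kap ->
  exists a, twice_spin r mu f = a + (p \in f) * window r kap p /\
            twice_spin r mu (ftog p f) = a + (p \notin f) * window r kap p.
Proof.
move=> r0 h; rewrite (halfway_window r0 h).
exists (twice_spin r mu (f `\ p)%fset).
have D1 f' : twice_spin r mu f' = twice_spin r mu (f' `\ p)%fset +
    (p \in f') * (window r mu p + fwindow r f' p + fwindow r f' (p - r%:Z)).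
  have [pf|pf] := boolP (p \in f'); first by rewrite mul1n -twice_spinD1.
  by rewrite mul0n addn0 mem_fsetD1.
by split; rewrite D1 // ftogD1 ftogE fwindow_ftog // fwindow_ftogB.
Qed.

Lemma window_lt r l p : 0 < r -> window r l p < r.
Proof.
case: r => // r _; rewrite ltnS -[leqRHS]card_ord -sum1_card.
by apply: leq_sum => i _; case: edge.
Qed.

(** The weight [w] is the identity for the spin and the constant 1 for the sizes. Terms are added on
    both sides to avoid truncated subtraction. *)
Lemma counts_flip r p s (w : nat -> nat) : 0 < r -> flips r p s ->
  \sum_(i < r) w i * counts (flip r p s) i + w (window r (shape s) p) =
  \sum_(i < r) w i * counts s i +
    w (window r (shape s) p) * ((p \in moves1 s) + (p \in moves2 s)).
Proof.
move=> r0 fl; have lt := window_lt (shape s) p r0.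
rewrite (bigD1 (Ordinal lt)) // [in RHS](bigD1 (Ordinal lt)) //=.
rewrite /flip fl /= eqxx.
rewrite (eq_bigr (fun i : 'I_r => w i * counts s i)) => [|i ne]; last first.
  by rewrite -val_eqE /= in ne; rewrite (negPf ne).
rewrite addnAC [RHS]addnAC; congr addn.
rewrite -mulnDr addnA -[X in _ + X = _]muln1 -mulnDr addn1 prednK //.
have /andP[_] := fl.
by case: (p \in _); case: (p \in _) => //=; lia.
Qed.

Definition spin_level r mu nu s := twice_spin r mu (moves1 s) +
  twice_spin r nu (moves2 s) + (\sum_(i < r) i * counts s i).*2.

Lemma spin_level_flip r mu nu p s : 0 < r -> stage r mu nu p s ->
  spin_level r mu nu (flip r p s) = spin_level r mu nu s.
Proof.
move=> r0 [h1 h2 _]; have [fl|nfl] := boolP (flips r p s); last by rewrite flip_id.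
have := counts_flip id r0 fl; rewrite /spin_level.
set S := \sum_(i < r) _; set S' := \sum_(i < r) _ => e.
move: S S' e => S S' e; rewrite /flip fl /=.
have [a [-> ->]] := twice_spin_ftog r0 h1; have [b [-> ->]] := twice_spin_ftog r0 h2.
by move: e; case: (p \in moves1 s); case: (p \in moves2 s) => /=; lia.
Qed.

Definition below p f : nat := \sum_(x <- f) (x < p)%R.
Definition above p f : nat := \sum_(x <- f) (p <= x)%R.

Lemma below_ftog p f : below p (ftog p f) = below p f.
Proof.
have D1 f' : below p f' = below p (f' `\ p)%fset.
  have [pf|pf] := boolP (p \in f'); last by rewrite mem_fsetD1.
  by rewrite /below (big_fsetD1 p) //= ltxx.
by rewrite D1 ftogD1 -D1.
Qed.

Lemma belowS p f : below (p + 1) f = below p f + (p \in f).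
Proof.
rewrite -sum_eq_mem /below -big_split; apply: eq_bigr => x _ /=; lia.
Qed.

Lemma aboveS p f : above p f = above (p + 1) f + (p \in f).
Proof.
rewrite -sum_eq_mem /above -big_split; apply: eq_bigr => x _ /=; lia.
Qed.

Lemma above_ftog p f : above (p + 1) (ftog p f) = above (p + 1) f.
Proof.
have D1 f' : above (p + 1) f' = above (p + 1) (f' `\ p)%fset.
  have [pf|pf] := boolP (p \in f'); last by rewrite mem_fsetD1.
  by rewrite /above (big_fsetD1 p) //=; have -> : (p + 1 <= p)%R = false by lia.
by rewrite D1 ftogD1 -D1.
Qed.

(** Moves of the first strip are counted once passed, those of the second until passed. The value is
    thus the size of [moves2] plus the counters at the left end, and the size of [moves1] plus the
    counters at the right end. *)
Definition weight_level r p s :=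
  below p (moves1 s) + above p (moves2 s) + \sum_(i < r) counts s i.

Lemma weight_level_flip r mu nu p s : 0 < r -> stage r mu nu p s ->
  weight_level r (p + 1) (flip r p s) = weight_level r p s.
Proof.
move=> r0 hs; rewrite /weight_level belowS [above p _]aboveS.
have [fl|nfl] := boolP (flips r p s); last first.
  have [h1 h2 _] := hs; have [h1' h2' _] := stage_flip_up r0 hs.
  rewrite flip_id // in h1' h2' *.
  (* The unchanged state satisfies the stages on both sides of [p]; whatever the beads at [p] and
     [p + r], one of them excludes a move at [p]. *)
  have n1 : p \notin moves1 s.
    case e: (edge (shape s) p || ~~ edge (shape s) (p + r%:Z)).
      exact: (halfway_notin_down r0 h1').
    by apply: (halfway_notin_up r0 h1); move: e; case: edge; case: edge.
  have n2 : p \notin moves2 s.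
    case e: (edge (shape s) p || ~~ edge (shape s) (p + r%:Z)).
      exact: (halfway_notin_down r0 h2').
    by apply: (halfway_notin_up r0 h2); move: e; case: edge; case: edge.
  by rewrite (negPf n1) (negPf n2) !addn0.
have := counts_flip (fun=> 1) r0 fl.
under eq_bigr => i _ do rewrite mul1n.
under [in RHS]eq_bigr => i _ do rewrite mul1n.
rewrite {2 3 4}/flip fl /= below_ftog above_ftog ftogE.
set S := \sum_(i < r) _; set S' := \sum_(i < r) _.
by case: (p \in moves1 s); case: (p \in moves2 s) => /=; lia.
Qed.

(** * The complete sweep *)

Fixpoint run r p n s := if n is n'.+1 then run r (p + 1) n' (flip r p s) else s.

Lemma run_cat r p a b s : run r p (a + b) s = run r (p + a%:Z) b (run r p a s).
Proof.
elim: a p s => [|a IH] p s /=; first by rewrite add0n addr0.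
by rewrite IH; congr run; lia.
Qed.

Lemma run_stage r mu nu p n s : 0 < r ->
  stage r mu nu p s -> stage r mu nu (p + n%:Z) (run r p n s).
Proof.
move=> r0; elim: n p s => [|n IH] p s hs /=; first by rewrite addr0.
have -> : (p + n.+1%:Z = p + 1 + n%:Z)%R by lia.
exact/IH/stage_flip_up.
Qed.

Lemma run_inj r p n : 0 < r -> injective (run r p n).
Proof.
move=> r0; elim: n p => [|n IH] p s t //= /IH; exact: (can_inj (flipK p ^~ r0)).
Qed.

Lemma run_stages r mu nu p n s : 0 < r ->
  (forall q, p <= q <= p + n%:Z -> stage r mu nu q s)%R -> run r p n s = s.
Proof.
move=> r0; elim: n p => [|n IH] p //= hs.
rewrite (flip_stages r0 (mu := mu) (nu := nu)); try by apply: hs; lia.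
by apply: IH => q hq; apply: hs; lia.
Qed.

Lemma run_onto r mu nu p n t : 0 < r -> stage r mu nu (p + n%:Z) t ->
  exists2 s, stage r mu nu p s & run r p n s = t.
Proof.
move=> r0; elim: n p => [|n IH] p /=; first by rewrite addr0; exists t.
have -> : (p + n.+1%:Z = p + 1 + n%:Z)%R by lia.
move=> /IH [s hs <-]; exists (flip r p s); first exact: stage_flip_down.
by rewrite flipK.
Qed.

Lemma in_moves_flip r p s x : x != p ->
  (x \in moves1 (flip r p s)) = (x \in moves1 s) /\
  (x \in moves2 (flip r p s)) = (x \in moves2 s).
Proof.
by move=> xp; rewrite /flip; case: ifP => //= _; rewrite !in_ftog (negPf xp) !addbF.
Qed.

Lemma in_moves_run r p n s x : (x < p)%R ->
  (x \in moves1 (run r p n s)) = (x \in moves1 s) /\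
  (x \in moves2 (run r p n s)) = (x \in moves2 s).
Proof.
elim: n p s => //= n IH p s xp; have [|-> ->] := IH (p + 1)%R (flip r p s); first lia.
by apply: in_moves_flip; lia.
Qed.

Lemma run_spin_level r mu nu p n s : 0 < r -> stage r mu nu p s ->
  spin_level r mu nu (run r p n s) = spin_level r mu nu s.
Proof.
move=> r0; elim: n p s => //= n IH p s hs.
by rewrite (IH _ _ (stage_flip_up r0 hs)) (spin_level_flip r0 hs).
Qed.

Lemma run_weight_level r mu nu p n s : 0 < r -> stage r mu nu p s ->
  weight_level r (p + n%:Z) (run r p n s) = weight_level r p s.
Proof.
move=> r0; elim: n p s => [|n IH] p s hs /=; first by rewrite addr0.
have -> : (p + n.+1%:Z = p + 1 + n%:Z)%R by lia.
by rewrite (IH _ _ (stage_flip_up r0 hs)) (weight_level_flip r0 hs).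
Qed.

Definition from_below r mu nu s := exists p, forall q, (q <= p)%R -> stage r mu nu q s.
Definition from_above r mu nu s := exists p, forall q, (p <= q)%R -> stage r mu nu q s.

Lemma beads_from_le r l p : beads_from r l p <= r.
Proof. by rewrite -[leqRHS]card_ord -sum1_card; apply: leq_sum => i _; case: edge. Qed.

Lemma fset_bounds f : exists a : int,
  forall x, x \in f -> (- a < x < a)%R.
Proof.
have [M hM] := fset_int_bound f.
by exists (M%:Z + 1)%R => x /hM; lia.
Qed.

Lemma edge_bounds l : exists a : int,
  (forall x, a <= x -> edge l x = false)%R /\ (forall x, x < - a -> edge l x)%R.
Proof.
exists ((part l 0)%:Z + (size l)%:Z)%R; split=> x hx.
  by apply: edge_gt; lia.
by apply: edge_lt; lia.
Qed.

(** With the sweep far to the left, any given place falls under the last clause of [halfway], the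
    condition for a strip going up from the shape. Conversely, far to the left there are only beads
    and no moves, so the other clauses hold trivially. *)
Lemma from_belowP r mu nu s : 0 < r ->
  from_below r mu nu s <->
  [/\ bead_strip r (shape s) (moves1 s) mu, bead_strip r (shape s) (moves2 s) nu &
      forall i, r <= i -> counts s i = 0].
Proof.
move=> r0.
have key m f l : bead_strip r l f m <->
    exists p, forall q, (q <= p)%R -> halfway r q m f l.
  split=> [h|[p h] x]; last first.
    have := h (Num.min p (x - r%:Z)%R) _ x; rewrite ge_min lexx => /(_ isT).
    by do !case: ifP => //; lia.
  have [a ha] := fset_bounds f; have [b [_ hb]] := edge_bounds m.
  have [c [_ hc]] := edge_bounds l.
  exists (Num.min (- a) (Num.min (- b) (- c)) - r%:Z)%R => q hq x.
  have [xq|xq] := ltP x (q + r%:Z)%R; last first.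
    by case: ifP => [|_]; [lia | exact: h].
  have [-> ->] : edge m x /\ edge l x by split; [apply: hb | apply: hc]; lia.
  have /negPf-> : x \notin f by apply/negP => /ha; lia.
  have /negPf-> : (x - r%:Z)%R \notin f by apply/negP => /ha; lia.
  by case: ifP.
split=> [[p h]|[/key [p1 h1] /key [p2 h2] hc]].
  split; try by apply/key; exists p => q /h [].
  by move=> i ri; have [_ _] := h p (lexx p); apply; apply: leq_trans ri; exact: beads_from_le.
have [b [_ hb]] := edge_bounds (shape s).
exists (Num.min (Num.min p1 p2) (- b - r%:Z))%R => q; rewrite !le_min => /andP[/andP[q1 q2] q3].
split; [exact: h1|exact: h2|move=> i hi; apply: hc; apply: leq_trans hi].
rewrite -[leqLHS]card_ord -sum1_card; apply: leq_sum => -[j hj] _ /=.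
by rewrite hb //; lia.
Qed.

Lemma from_aboveP r mu nu s : 0 < r ->
  from_above r mu nu s <->
  [/\ bead_strip r mu (moves1 s) (shape s), bead_strip r nu (moves2 s) (shape s) &
      forall i, counts s i = 0].
Proof.
move=> r0.
have key m f l : bead_strip r l f m <->
    exists p, forall q, (p <= q)%R -> halfway r q l f m.
  split=> [h|[p h] x]; last first.
    have := h (Num.max p (x + 1)%R) _ x; rewrite le_max lexx => /(_ isT).
    by case: ifP => [_ []//|]; lia.
  have [a ha] := fset_bounds f; have [b [hb _]] := edge_bounds m.
  have [c [hc _]] := edge_bounds l.
  exists (Num.max a (Num.max b c) + r%:Z)%R => q hq x.
  have [xq|xq] := ltP x q; first by have [-> ?] := h x.
  have [-> ->] : edge m x = false /\ edge l x = false by split; [apply: hb | apply: hc]; lia.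
  have /negPf-> : x \notin f by apply/negP => /ha; lia.
  have /negPf-> : (x - r%:Z)%R \notin f by apply/negP => /ha; lia.
  by case: ifP.
split=> [[p h]|[/key [p1 h1] /key [p2 h2] hc]].
  split; try by apply/key; exists p => q /h [].
  have [b [hb _]] := edge_bounds (shape s).
  move=> i; have pb : (p <= Num.max p b)%R by rewrite le_max lexx.
  have [_ _] := h _ pb; apply.
  rewrite /beads_from big1 // => -[j hj] _ /=.
  by rewrite hb //; have : (b <= Num.max p b)%R by [rewrite le_max lexx orbT]; lia.
exists (Num.max p1 p2)%R => q; rewrite ge_max => /andP[q1 q2].
by split=> [||i _]; [exact: h1|exact: h2|exact: hc].
Qed.

(** A point [x] of [f] with [x >= p] would, by the last clause at [x + r], put [x + r] into [f] as
    well, and so on without end. *)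
Lemma halfway_high r p mu f kap : 0 < r -> halfway r p mu f kap ->
    (forall x, p <= x -> edge mu x = false)%R ->
  (forall x, p <= x -> x \notin f)%R /\
  (forall x, p + r%:Z <= x -> edge kap x = false)%R.
Proof.
move=> r0 h hmu; have [a ha] := fset_bounds f.
have nf x : (p <= x)%R -> x \notin f.
  have [n] : exists n : nat, (a <= x + n%:Z)%R by exists (`|a| + `|x|); lia.
  elim/ltn_ind: n x => n IH x hn px.
  have [n0|n0] := posnP n; first by apply/negP => /ha; lia.
  have := h (x + r%:Z)%R; rewrite addrK hmu; last lia.
  have /negPf-> : (x + r%:Z)%R \notin f by apply: (IH n.-1); lia.
  by do !case: ifP; case: (x \in f); case: edge => //; lia.
split=> // x hx; have := h x; rewrite hmu; last lia.
rewrite (negPf (nf x _)); last lia.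
by do !case: ifP; case: edge => //; lia.
Qed.

Lemma stages_above r mu nu p s : 0 < r -> stage r mu nu p s ->
    (forall x, p <= x -> edge mu x = false)%R ->
    (forall x, p <= x -> edge nu x = false)%R ->
    (forall x, p <= x -> edge (shape s) x = false)%R ->
  forall q, (p <= q)%R -> stage r mu nu q s.
Proof.
move=> r0 [h1 h2 hc] hmu hnu hs q pq.
have half m f : halfway r p m f (shape s) -> (forall x, p <= x -> edge m x = false)%R ->
    halfway r q m f (shape s).
  move=> hm em x; have [nf _] := halfway_high r0 hm em.
  have := hm x; have [xp|xp] := ltP x p; first by case: ifP => //; lia.
  rewrite em // hs // (negPf (nf _ xp)) /=.
  by do !case: ifP => //; case: (_ \in f) => //=; lia.
split; [exact: half|exact: half|move=> i _; apply: hc].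
by rewrite /beads_from big1 // => -[a ha] _ /=; rewrite hs //; lia.
Qed.

(** Termination of the sweep. Beyond the beads of [mu] and [nu] no moves are left, so a flip uses up
    a unit of a counter, while a step without flip lowers the distance [j] to the end of the beads
    of the shape. *)
Lemma reach_above r mu nu p n s j : 0 < r -> stage r mu nu p s ->
    (forall x, p <= x -> edge mu x = false)%R ->
    (forall x, p <= x -> edge nu x = false)%R ->
    (forall x, p + j%:Z <= x -> edge (shape s) x = false)%R ->
    (\sum_(i < r) counts s i) * r.+1 + j <= n ->
  exists n', forall q, (p + n'%:Z <= q)%R -> stage r mu nu q (run r p n' s).
Proof.
move=> r0; elim: n p s j => [|n IH] p s j hs hmu hnu hj hn.
  have j0 : j = 0 by lia.
  rewrite j0 addr0 in hj; exists 0 => q; rewrite addr0; exact: stages_above.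
have [j0|j0] := posnP j.
  rewrite j0 addr0 in hj; exists 0 => q; rewrite addr0; exact: stages_above.
have [h1 h2 hc] := hs.
have [f1 k1] := halfway_high r0 h1 hmu; have [f2 k2] := halfway_high r0 h2 hnu.
have [fl|nfl] := boolP (flips r p s).
  have [n' hn'] : exists n', forall q, (p + 1 + n'%:Z <= q)%R ->
      stage r mu nu q (run r (p + 1) n' (flip r p s)).
    (* The flip puts a bead at [p + r], so the distance is reset to [r]; the unit of counter used up
       weighs [r + 1] and pays for this. *)
    apply: (IH _ _ r (stage_flip_up r0 hs)); try by move=> x hx; [apply: hmu; lia].
    - by move=> x hx; apply: hnu; lia.
    - move=> x hx; have /andP[ne _] := fl; rewrite /flip fl /= edge_tog // /toggled k1; last lia.
      by have -> : (x == p) = false by [lia]; have -> : (x == p + r%:Z)%R = false by lia.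
    have := counts_flip (fun=> 1) r0 fl.
    under eq_bigr => i _ do rewrite mul1n.
    under [in X in _ = X -> _]eq_bigr => i _ do rewrite mul1n.
    rewrite (negPf (f1 p (lexx p))) (negPf (f2 p (lexx p))).
    move: hn; set S := \sum_(i < r) _; set S' := \sum_(i < r) _ => hn e.
    by move: hn; have -> : S = S'.+1 by [lia]; rewrite mulSn; lia.
  by exists n'.+1 => q hq /=; apply: hn'; lia.
have [n' hn'] : exists n', forall q, (p + 1 + n'%:Z <= q)%R ->
    stage r mu nu q (run r (p + 1) n' (flip r p s)).
  apply: (IH _ _ j.-1 (stage_flip_up r0 hs)); rewrite ?flip_id //.
  - by move=> x hx; apply: hmu; lia.
  - by move=> x hx; apply: hnu; lia.
  - by move=> x hx; apply: hj; lia.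
  by lia.
by exists n'.+1 => q hq /=; apply: hn'; lia.
Qed.

Lemma stages_below r mu nu p s : 0 < r -> stage r mu nu p s ->
    (forall x, x < p + r%:Z -> edge mu x /\ edge nu x)%R ->
    (forall x, x < p -> x \notin moves1 s /\ x \notin moves2 s)%R ->
  forall q, (q <= p)%R -> stage r mu nu q s.
Proof.
move=> r0 [h1 h2 hc] he hf q qp.
have half m f : halfway r p m f (shape s) -> (forall x, x < p + r%:Z -> edge m x)%R ->
    (forall x, x < p -> x \notin f)%R ->
    halfway r q m f (shape s) /\ (forall x, x < p + r%:Z -> edge (shape s) x)%R.
  move=> hm em nf; have es x : (x < p + r%:Z)%R -> edge (shape s) x /\ x \notin f.
    move=> xp; have := hm x; rewrite (negPf (nf (x - r%:Z)%R _)); last lia.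
    rewrite em //; case: ifP => [xp'|_].
      by rewrite (negPf (nf _ xp')); case: edge => //; lia.
    by rewrite xp; case: (x \in f); case: edge => //; lia.
  split=> [x|x /es []//]; have := hm x.
  have [xp|xp] := ltP x (p + r%:Z)%R; last by do !case: ifP => //; lia.
  rewrite (negPf (nf (x - r%:Z)%R _)); last lia.
  by have [-> /negPf->] := es x xp; rewrite em //; do !case: ifP.
have [g1 e1] := half _ _ h1 (fun x hx => (he x hx).1) (fun x hx => (hf x hx).1).
have [g2 _] := half _ _ h2 (fun x hx => (he x hx).2) (fun x hx => (hf x hx).2).
split=> // i hi; apply: hc; apply: leq_trans (beads_from_le _ _ _) _.
apply: leq_trans hi; rewrite -[leqLHS]card_ord -sum1_card; apply: leq_sum => -[a ha] _ /=.
by rewrite e1 //; lia.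
Qed.

(** Both ends are stationary, so the range given by [p] and [n] can be enlarged at will; this makes
    two trajectories comparable. *)
Definition trajectory r mu nu s t := exists p n,
  [/\ forall q, (q <= p)%R -> stage r mu nu q s,
      forall q, (p + n%:Z <= q)%R -> stage r mu nu q t &
      run r p n s = t].

Lemma trajectory_up r mu nu s : 0 < r -> from_below r mu nu s ->
  exists t, trajectory r mu nu s t.
Proof.
move=> r0 [p hp]; have [a [ha _]] := edge_bounds mu; have [b [hb _]] := edge_bounds nu.
(* After [n] steps the sweep is past all beads of [mu] and [nu]. *)
pose n := `|p| + `|a| + `|b|.
have hs := run_stage n r0 (hp p (lexx p)).
have [c [hc _]] := edge_bounds (shape (run r p n s)).
have [|||n' hn'] := @reach_above r mu nu _ _ _ (`|c| + `|(p + n%:Z)%R|) r0 hs _ _ _ (leqnn _).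
- by move=> x hx; apply: ha; rewrite /n in hx; lia.
- by move=> x hx; apply: hb; rewrite /n in hx; lia.
- by move=> x hx; apply: hc; lia.
exists (run r p (n + n') s), p, (n + n'); split=> // q hq; rewrite run_cat.
by apply: hn'; lia.
Qed.

Lemma trajectory_down r mu nu t : 0 < r -> from_above r mu nu t ->
  exists s, trajectory r mu nu s t.
Proof.
move=> r0 [p hp]; have [a [_ ha]] := edge_bounds mu; have [b [_ hb]] := edge_bounds nu.
have [c hc] := fset_bounds (moves1 t); have [d hd] := fset_bounds (moves2 t).
(* Far enough left that [mu] and [nu] have only beads below [p - n + r] and [t] has no moves below
   [p - n]. The run does not touch memberships there, so [s] has none either and no termination
   argument is needed. *)
pose n := `|p| + `|a| + `|b| + `|c| + `|d| + r.
have [|s hs rs] := @run_onto r mu nu (p - n%:Z)%R n t r0; first by apply: hp; lia.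
exists s, (p - n%:Z)%R, n; split=> //; last by move=> q hq; apply: hp; lia.
apply: stages_below => // x xp.
  by split; [apply: ha|apply: hb]; rewrite /n in xp; lia.
have [] := in_moves_run r n s xp; rewrite rs => <- <-.
by split; apply/negP; [move=> /hc|move=> /hd]; rewrite /n in xp; lia.
Qed.

Lemma trajectory_run r mu nu s t : 0 < r -> trajectory r mu nu s t ->
  exists p n, forall p' n', (p' <= p)%R -> (p + n%:Z <= p' + n'%:Z)%R ->
    [/\ stage r mu nu p' s, stage r mu nu (p' + n'%:Z)%R t & run r p' n' s = t].
Proof.
move=> r0 [p [n [hs ht e]]]; exists p, n => p' n' hp hn; split; [exact: hs|exact: ht|].
(* The [a] extra steps before [p] and the [b] extra steps after [p + n] change nothing, by
   [run_stages]. *)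
pose a := `|(p - p')%R|; pose b := n' - (a + n).
have -> : n' = a + (n + b) by rewrite /b /a; lia.
rewrite run_cat (_ : run r p' a s = s); last first.
  by apply: (run_stages (mu := mu) (nu := nu)) => // q hq; apply: hs; rewrite /a in hq; lia.
have -> : (p' + a%:Z = p)%R by rewrite /a; lia.
rewrite run_cat e (run_stages (mu := mu) (nu := nu)) //.
by move=> q hq; apply: ht; lia.
Qed.

Lemma trajectory_common r mu nu s t s' t' : 0 < r ->
    trajectory r mu nu s t -> trajectory r mu nu s' t' ->
  exists p n, run r p n s = t /\ run r p n s' = t'.
Proof.
move=> r0 /(trajectory_run r0) [p [n h]] /(trajectory_run r0) [p' [n' h']].
exists (Num.min p p'), (n + n' + `|(p - p')%R|).
have [] := h (Num.min p p') (n + n' + `|(p - p')%R|); try by lia.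
have [] := h' (Num.min p p') (n + n' + `|(p - p')%R|); try by lia.
by [].
Qed.

Lemma trajectory_fun r mu nu s t t' : 0 < r ->
  trajectory r mu nu s t -> trajectory r mu nu s t' -> t = t'.
Proof. by move=> r0 h h'; have [p [n [<- <-]]] := trajectory_common r0 h h'. Qed.

Lemma trajectory_inj r mu nu s s' t : 0 < r ->
  trajectory r mu nu s t -> trajectory r mu nu s' t -> s = s'.
Proof.
move=> r0 h h'; have [p [n [e1 e2]]] := trajectory_common r0 h h'.
by apply: (run_inj r0 (p := p) (n := n)); rewrite e1 e2.
Qed.

Lemma trajectory_spin r mu nu s t : 0 < r -> trajectory r mu nu s t ->
  spin_level r mu nu t = spin_level r mu nu s.
Proof.
move=> r0 /(trajectory_run r0) [p [n h]]; have [||hs _ <-] := h p n; rewrite ?lexx //.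
exact: run_spin_level.
Qed.

Lemma trajectory_weight r mu nu s t : 0 < r -> trajectory r mu nu s t ->
  #|` moves1 t| + \sum_(i < r) counts t i = #|` moves2 s| + \sum_(i < r) counts s i.
Proof.
move=> r0 /(trajectory_run r0) [p [n h]].
have [a ha] := fset_bounds (moves1 s `|` moves2 s `|` moves1 t `|` moves2 t)%fset.
(* The enlarged range contains every move of [s] and [t], so [below] and [above] become sizes or
   zero at its ends. *)
pose p' := (Num.min p (- a))%R; pose n' := n + `|(p - p')%R| + `|p'| + `|a|.
have [||hs _ e] := h p' n'; try by rewrite /n' /p'; lia.
have := run_weight_level n' r0 hs; rewrite e /weight_level.
have belowE q f : (forall x, x \in f -> x < q)%R -> below q f = #|` f|.
  move=> hf; rewrite /below big_seq (eq_bigr (fun=> 1)) -?big_seq.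
    by rewrite sum1_size.
  by move=> x /hf ->.
have aboveE q f : (forall x, x \in f -> q <= x)%R -> above q f = #|` f|.
  move=> hf; rewrite /above big_seq (eq_bigr (fun=> 1)) -?big_seq.
    by rewrite sum1_size.
  by move=> x /hf ->.
have below0 q f : (forall x, x \in f -> q <= x)%R -> below q f = 0.
  by move=> hf; rewrite /below big_seq big1 // => x /hf; rewrite leNgt => /negPf->.
have above0 q f : (forall x, x \in f -> x < q)%R -> above q f = 0.
  by move=> hf; rewrite /above big_seq big1 // => x /hf; rewrite ltNge => /negPf->.
rewrite (belowE (p' + n'%:Z)%R (moves1 t)) ?(above0 (p' + n'%:Z)%R (moves2 t))
  ?(below0 p' (moves1 s)) ?(aboveE p' (moves2 s)) ?addn0 //.
all: move=> x hx; have := ha x; rewrite !in_fsetU hx ?orbT => /(_ isT);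
  rewrite /n' /p'; lia.
Qed.

Definition swap s := State (shape s) (moves2 s) (moves1 s) (counts s).

Lemma flip_swap r p s : flip r p (swap s) = swap (flip r p s).
Proof.
rewrite /flip; have -> : flips r p (swap s) = flips r p s by rewrite /flips /= orbCA.
case: ifP => // _; congr State; apply: funext => i /=.
by case: ifP => // _; rewrite addnAC.
Qed.

Lemma run_swap r p n s : run r p n (swap s) = swap (run r p n s).
Proof. by elim: n p s => //= n IH p s; rewrite flip_swap IH. Qed.

Lemma trajectory_swap r mu nu s t :
  trajectory r mu nu s t -> trajectory r nu mu (swap s) (swap t).
Proof.
move=> [p [n [hs ht e]]]; exists p, n; split; last by rewrite run_swap e.
  by move=> q /hs [].
by move=> q /ht [].
Qed.

(** * The local rule of a growth diagram *)

Definition ffun_nat r (c : {ffun 'I_r -> nat}) (i : nat) : nat := oapp c 0 (insub i).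

Lemma ffun_natE r (c : {ffun 'I_r -> nat}) (i : 'I_r) : ffun_nat c i = c i.
Proof. by rewrite /ffun_nat valK. Qed.

Lemma ffun_nat_out r (c : {ffun 'I_r -> nat}) i : r <= i -> ffun_nat c i = 0.
Proof. by move=> ri; rewrite /ffun_nat insubF // ltnNge ri. Qed.

Lemma ffun_nat_inj r : injective (@ffun_nat r).
Proof. by move=> c d e; apply/ffunP => i; rewrite -!ffun_natE e. Qed.

Section Cell.
Variables (r : nat) (r0 : 0 < r).
Implicit Type c : {ffun 'I_r -> nat}.

Definition cell c lam mu nu kap := exists s t,
  [/\ trajectory r mu nu s t, shape s = lam, shape t = kap & counts s = ffun_nat c].

Lemma cell_sym c lam mu nu kap : cell c lam mu nu kap -> cell c lam nu mu kap.
Proof. by move=> [s [t [/trajectory_swap h *]]]; exists (swap s), (swap t). Qed.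

Lemma trajectory_ends mu nu s t :
  trajectory r mu nu s t -> from_below r mu nu s /\ from_above r mu nu t.
Proof. by move=> [p [n [hs ht _]]]; split; [exists p | exists (p + n%:Z)%R]. Qed.

Lemma cell_strips c lam mu nu kap : cell c lam mu nu kap ->
  [/\ horizontal_strip r lam mu, horizontal_strip r lam nu,
      horizontal_strip r mu kap & horizontal_strip r nu kap].
Proof.
move=> [s [t [/trajectory_ends [/(from_belowP _ _ _ r0) + /(from_aboveP _ _ _ r0)]]]].
move=> [h1 h2 _] [h3 h4 _] <- <- _.
by split; apply/(horizontal_stripP _ _ r0); [exists (moves1 s) | exists (moves2 s)
  | exists (moves1 t) | exists (moves2 t)].
Qed.

Lemma cell_up c lam mu nu : horizontal_strip r lam mu -> horizontal_strip r lam nu ->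
  exists kap, cell c lam mu nu kap.
Proof.
move=> /(horizontal_stripP _ _ r0) [f1 h1] /(horizontal_stripP _ _ r0) [f2 h2].
have [|t ht] := @trajectory_up r mu nu (State lam f1 f2 (ffun_nat c)) r0.
  by apply/from_belowP => //; split=> // i; exact: ffun_nat_out.
by exists (shape t), (State lam f1 f2 (ffun_nat c)), t.
Qed.

Lemma cell_down mu nu kap : horizontal_strip r mu kap -> horizontal_strip r nu kap ->
  exists lam c, cell c lam mu nu kap.
Proof.
move=> /(horizontal_stripP _ _ r0) [f1 h1] /(horizontal_stripP _ _ r0) [f2 h2].
have [|s hs] := @trajectory_down r mu nu (State kap f1 f2 (fun=> 0)) r0.
  by apply/from_aboveP.
exists (shape s), [ffun i : 'I_r => counts s i], s, (State kap f1 f2 (fun=> 0)).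
split=> //; apply: funext => i.
have [/(from_belowP _ _ _ r0) [_ _ sc] _] := trajectory_ends hs.
have [ri|ir] := leqP r i; first by rewrite sc // ffun_nat_out.
by rewrite -[i]/(val (Ordinal ir)) ffun_natE ffunE.
Qed.

(** The two strips leaving [lam] determine their sets of moves, hence the initial state of the
    sweep. *)
Lemma cell_fun c lam mu nu kap kap' :
  cell c lam mu nu kap -> cell c lam mu nu kap' -> kap = kap'.
Proof.
move=> [s [t [h es et ec]]] [s' [t' [h' es' et' ec']]].
have [/(from_belowP _ _ _ r0) [a1 a2 _] _] := trajectory_ends h.
have [/(from_belowP _ _ _ r0) [b1 b2 _] _] := trajectory_ends h'.
rewrite -et -et'; congr shape; apply: trajectory_fun h _ => //; move: h'.
case: s s' es ec a1 a2 es' ec' b1 b2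
  => [k1 f1 f2 c1] [k2 f1' f2' c2] /= -> -> a1 a2 -> -> b1 b2.
by rewrite (bead_strip_uniq r0 a1 b1) (bead_strip_uniq r0 a2 b2).
Qed.

(** The two strips reaching [kap] determine their sets of moves and the final counters vanish, so
    the final state is known; the sweep is reversible. *)
Lemma cell_inj c c' lam lam' mu nu kap :
  cell c lam mu nu kap -> cell c' lam' mu nu kap -> lam = lam' /\ c = c'.
Proof.
move=> [s [t [h es et ec]]] [s' [t' [h' es' et' ec']]].
have [_ /(from_aboveP _ _ _ r0) [a1 a2 a3]] := trajectory_ends h.
have [_ /(from_aboveP _ _ _ r0) [b1 b2 b3]] := trajectory_ends h'.
suff tt' : t = t'.
  rewrite -tt' in h'; have ss' := trajectory_inj r0 h h'.
  by split; [rewrite -es -es' ss' | apply: ffun_nat_inj; rewrite -ec -ec' ss'].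
case: t t' et et' a1 a2 a3 b1 b2 b3 {h h'}
  => [k1 f1 f2 c1] [k2 f1' f2' c2] /= -> -> a1 a2 a3 b1 b2 b3.
rewrite (bead_strip_uniq r0 a1 b1) (bead_strip_uniq r0 a2 b2).
by congr State; apply: funext => i; rewrite a3 b3.
Qed.

Lemma cell_size c lam mu nu kap : cell c lam mu nu kap ->
  strip_size r mu kap = strip_size r lam nu + vsum c.
Proof.
move=> [s [t [h es et ec]]].
have [/(from_belowP _ _ _ r0) [_ a2 _] /(from_aboveP _ _ _ r0) [b1 _ b3]] := trajectory_ends h.
have := trajectory_weight r0 h; rewrite [X in _ + X = _]big1 // addn0.
rewrite -es -et (standardisation_bead_strip r0 b1).1 (standardisation_bead_strip r0 a2).1 => ->.
by congr addn; apply: eq_bigr => i _; rewrite ec ffun_natE.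
Qed.

Lemma cell_spin c lam mu nu kap : cell c lam mu nu kap ->
  (strip_spin r mu kap + strip_spin r nu kap =
   strip_spin r lam mu + strip_spin r lam nu + (vn c)%:R)%R.
Proof.
move=> [s [t [h es et ec]]].
have [/(from_belowP _ _ _ r0) [a1 a2 _] /(from_aboveP _ _ _ r0) [b1 b2 b3]] := trajectory_ends h.
have := trajectory_spin r0 h; rewrite /spin_level [X in _ + X.*2 = _]big1; last first.
  by move=> i _; rewrite b3 muln0.
rewrite addn0 -es -et (standardisation_bead_strip r0 a1).2 (standardisation_bead_strip r0 a2).2.
rewrite (standardisation_bead_strip r0 b1).2 (standardisation_bead_strip r0 b2).2.
(* The spins of the strips reaching [kap] are moved from their upper ends to [mu] and [nu], where
   [spin_level] computes them. *)
rewrite !(twice_spin_strip r0 b1) !(twice_spin_strip r0 b2) -!mulrDl -!natrD => ->.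
have -> : \sum_(i < r) i * counts s i = vn c.
  by apply: eq_bigr => i _; rewrite ec ffun_natE.
by rewrite natrD mulrDl -muln2 natrM mulfK.
Qed.

Lemma horizontal_strip_refl l : horizontal_strip r l l.
Proof. by apply/horizontal_stripP => //; exists fset0; exact: bead_strip0. Qed.

Lemma strip_size_refl l : strip_size r l l = 0.
Proof. by have [-> _] := standardisation_bead_strip r0 (bead_strip0 r l). Qed.

Lemma strip_spin_refl l : strip_spin r l l = 0%R.
Proof.
have [_ ->] := standardisation_bead_strip r0 (bead_strip0 r l).
by rewrite /twice_spin big_seq_fset0 mul0r.
Qed.

End Cell.

(** * Growth diagrams *)

Section Growth.
Variables (r : nat) (r0 : 0 < r) (g : intpart).
Implicit Type A : nat -> nat -> {ffun 'I_r -> nat}.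

Definition insert (c : {ffun 'I_r -> nat}) lam mu nu : intpart :=
  xget lam [set kap | cell c lam mu nu kap]%classic.

Definition delete mu nu kap : intpart * {ffun 'I_r -> nat} :=
  xget (kap, [ffun=> 0]) [set lc | cell lc.2 lc.1 mu nu kap]%classic.

Lemma insertP c lam mu nu : horizontal_strip r lam mu -> horizontal_strip r lam nu ->
  cell c lam mu nu (insert c lam mu nu).
Proof.
move=> h1 h2; have [kap h] := cell_up r0 c h1 h2.
exact: (@xgetPex _ lam [set kap | cell c lam mu nu kap]%classic (ex_intro _ kap h)).
Qed.

Lemma deleteP mu nu kap : horizontal_strip r mu kap -> horizontal_strip r nu kap ->
  cell (delete mu nu kap).2 (delete mu nu kap).1 mu nu kap.
Proof.
move=> h1 h2; have [lam [c h]] := cell_down r0 h1 h2.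
exact: (@xgetPex _ (kap, [ffun=> 0]) [set lc | cell lc.2 lc.1 mu nu kap]%classic
  (ex_intro _ (lam, c) h)).
Qed.

Fixpoint grow A i : nat -> intpart :=
  if i is i'.+1 then
    fix row j := if j is j'.+1 then
      insert (A i' j') (grow A i' j') (grow A i' j'.+1) (row j') else g
  else fun=> g.

Lemma grow_strips A i j :
  horizontal_strip r (grow A i j) (grow A i j.+1) /\
  horizontal_strip r (grow A i j) (grow A i.+1 j).
Proof.
(* If row [a] is a chain of strips, then, cell after cell, the steps from row [a] to the next row
   are strips too. *)
have step a : (forall b, horizontal_strip r (grow A a b) (grow A a b.+1)) ->
    forall b, horizontal_strip r (grow A a b) (grow A a.+1 b).
  move=> h; elim=> [|b IH]; first by case: (a) => [|?]; exact: horizontal_strip_refl.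
  by have [] := cell_strips r0 (insertP (A a b) (h b) IH).
suff rows a : forall b, horizontal_strip r (grow A a b) (grow A a b.+1).
  by split; [exact: rows | apply: step].
elim: a => [|a IH] b; first exact: horizontal_strip_refl.
by have [] := cell_strips r0 (insertP (A a b) (IH b) (step _ IH b)).
Qed.

Lemma grow_cell A i j :
  cell (A i j) (grow A i j) (grow A i j.+1) (grow A i.+1 j) (grow A i.+1 j.+1).
Proof. by have [h1 h2] := grow_strips A i j; exact: insertP. Qed.

Lemma grow0r A i : grow A i 0 = g.
Proof. by case: i. Qed.

(** The local rule is symmetric in [mu] and [nu] and determines [kap], so the symmetry propagates
    cell by cell. *)
Lemma grow_tr A i j : grow (fun a b => A b a) j i = grow A i j.
Proof.
elim: i j => [|i IHi] j; first by rewrite grow0r.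
elim: j => [|j IHj]; first by rewrite grow0r.
have := grow_cell (fun a b => A b a) j i; rewrite !IHi IHj => /cell_sym h.
exact: (cell_fun r0 h (grow_cell A i j)).
Qed.

Lemma grow_row_size A i j :
  strip_size r (grow A i j) (grow A i j.+1) = \sum_(a < i) vsum (A a j).
Proof.
elim: i => [|i IH]; first by rewrite big_ord0 strip_size_refl.
by rewrite big_ord_recr /= -IH; have := cell_size r0 (cell_sym (grow_cell A i j)).
Qed.

Lemma grow_col_size A i j :
  strip_size r (grow A i j) (grow A i.+1 j) = \sum_(b < j) vsum (A i b).
Proof.
elim: j => [|j IH]; first by rewrite big_ord0 !grow0r strip_size_refl.
by rewrite big_ord_recr /= -IH; have := cell_size r0 (grow_cell A i j).
Qed.

(** By [cell_spin], pushing a lattice path across a cell raises its total spin by the [vn] of that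
    cell; the initial path along the border is constant and has spin 0. *)
Lemma grow_spin A (m n : nat) :
  (\sum_(j < n) strip_spin r (grow A m j) (grow A m j.+1) +
   \sum_(i < m) strip_spin r (grow A i n) (grow A i.+1 n) =
   (\sum_(i < m) \sum_(j < n) vn (A i j))%:R)%R.
Proof.
elim: m => [|m IH].
  by rewrite !big_ord0 addr0 big1 // => j _; exact: strip_spin_refl.
suff row : (strip_spin r (grow A m n) (grow A m.+1 n) +
   \sum_(j < n) strip_spin r (grow A m.+1 j) (grow A m.+1 j.+1) =
   \sum_(j < n) strip_spin r (grow A m j) (grow A m j.+1) +
   (\sum_(j < n) vn (A m j))%:R :> rat)%R.
  by rewrite !big_ord_recr /= natrD -IH; lra.
elim: n {IH} => [|n IH].
  by rewrite !big_ord0 !grow0r strip_spin_refl.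
by have := cell_spin r0 (grow_cell A m n); rewrite !big_ord_recr /= natrD; lra.
Qed.

(** The diagram is recovered backwards from its outer border by [cell_inj]; in the induction [k]
    bounds the distance to the corner (m, n). *)
Lemma grow_inj A B (m n : nat) :
    (forall j, j <= n -> grow A m j = grow B m j) ->
    (forall i, i <= m -> grow A i n = grow B i n) ->
  forall i j, i < m -> j < n -> A i j = B i j.
Proof.
move=> hrow hcol.
have key (k i j : nat) : i <= m -> j <= n -> (m - i) + (n - j) <= k -> grow A i j = grow B i j.
  elim: k i j => [|k IH] i j im jn hk.
    have -> : i = m by lia.
    exact: hrow.
  have [->|ne] := eqVneq i m; first exact: hrow.
  have [->|ne'] := eqVneq j n; first exact: hcol.
  have := grow_cell A i j; have := grow_cell B i j.
  rewrite (IH i j.+1) ?(IH i.+1 j) ?(IH i.+1 j.+1); try by lia.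
  by move=> h1 h2; have [] := cell_inj r0 h2 h1.
move=> i j im jn; have := grow_cell A i j; have := grow_cell B i j.
have k i' j' : i' <= m -> j' <= n -> grow A i' j' = grow B i' j'.
  by move=> hi hj; apply: key (leqnn _).
rewrite !k; try by lia.
by move=> h1 h2; have [] := cell_inj r0 h2 h1.
Qed.

(** * Backward growth from two tableaux *)

Section Shrink.
Variables (P Q : nat -> intpart).

(* Counted from the corner shared by P and Q, so that both indices run
   against the direction of growth. *)
Fixpoint shrink (n m a : nat) : nat -> intpart :=
  if a is a'.+1 then
    fix row b := if b is b'.+1 then
      (delete (row b') (shrink n m a' b'.+1) (shrink n m a' b')).1 else Q (m - a'.+1)
  else fun b => P (n - b).

Variables m n : nat.
Hypotheses (PQ : P n = Q m) (P0 : P 0 = g) (Q0 : Q 0 = g).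
Hypothesis hP : forall j, j < n -> horizontal_strip r (P j) (P j.+1).
Hypothesis hQ : forall i, i < m -> horizontal_strip r (Q i) (Q i.+1).
Local Notation H := (shrink n m).

Lemma shrink0r a : H a 0 = Q (m - a).
Proof. by case: a => [|a] //=; rewrite !subn0. Qed.

Lemma shrink_strips a b :
  (a <= m -> b < n -> horizontal_strip r (H a b.+1) (H a b)) /\
  (a < m -> b <= n -> horizontal_strip r (H a.+1 b) (H a b)).
Proof.
have step a' : (a' < m) -> (forall b, b < n -> horizontal_strip r (H a' b.+1) (H a' b)) ->
    forall b, b <= n -> horizontal_strip r (H a'.+1 b) (H a' b).
  move=> am h; elim=> [|b' IH] bn.
    rewrite !shrink0r; have := hQ (i := m - a'.+1).
    by have -> : (m - a'.+1).+1 = m - a' by [lia]; apply; lia.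
  by have [] := cell_strips r0 (deleteP (IH (ltnW bn)) (h b' bn)).
suff rows a' : a' <= m -> forall b, b < n -> horizontal_strip r (H a' b.+1) (H a' b).
  by split=> *; [exact: rows | apply: step => // *; apply: rows => //; exact: ltnW].
elim: a' => [|a' IH] am b' bn.
  rewrite /=; have := hP (j := n - b'.+1).
  by have -> : (n - b'.+1).+1 = n - b' by [lia]; apply; lia.
have IH' := IH (ltnW am).
by have [] := cell_strips r0 (deleteP (step _ am IH' b' (ltnW bn)) (IH' b' bn)).
Qed.

Lemma shrink_cell a b : a < m -> b < n ->
  cell (delete (H a.+1 b) (H a b.+1) (H a b)).2
    (H a.+1 b.+1) (H a.+1 b) (H a b.+1) (H a b).
Proof.
move=> am bn; apply: deleteP.
  by have [_ h] := shrink_strips a b; apply: h => //; exact: ltnW.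
by have [h _] := shrink_strips a b; apply: h => //; exact: ltnW.
Qed.

Hypothesis core_g : core r g.

Lemma strip_ribbon_le l l' : horizontal_strip r l l' -> ribbon_le r l l'.
Proof. by case=> c; exact: standardisation_ribbon_le. Qed.

(** The row is a chain of strips whose top is [Q 0 = g], and below a core there is only the core
    itself. *)
Lemma shrink_end_row b : b <= n -> H m b = g.
Proof.
move=> bn; apply: core_g; have -> : g = H m 0 by rewrite shrink0r subnn.
elim: b bn => [|b IH] bn; first exact: rt_refl.
apply: rt_trans (IH (ltnW bn)); apply: strip_ribbon_le.
by have [h _] := shrink_strips m b; apply: h.
Qed.

Lemma shrink_end_col a : a <= m -> H a n = g.
Proof.
move=> am; apply: core_g; have -> : g = H 0 n by rewrite /= subnn.
elim: a am => [|a IH] am; first exact: rt_refl.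
apply: rt_trans (IH (ltnW am)); apply: strip_ribbon_le.
by have [_ h] := shrink_strips a n; apply: h.
Qed.

(** The matrix collects the vectors returned by [delete]. The backward diagram has [g] on its
    border, so forward growth rebuilds it by [cell_fun]. *)
Lemma grow_onto : exists A,
  (forall j, j <= n -> grow A m j = P j) /\ (forall i, i <= m -> grow A i n = Q i).
Proof.
(* Cell (i, j) has its far corner at (i + 1, j + 1), whose indices counted backwards are [a] and
   [b]. *)
pose A i j := let a := m - i.+1 in let b := n - j.+1 in
  (delete (H a.+1 b) (H a b.+1) (H a b)).2.
have key i j : i <= m -> j <= n -> grow A i j = H (m - i) (n - j).
  elim: i j => [|i IHi] j im jn; first by rewrite subn0 shrink_end_row //; lia.
  elim: j jn => [|j IHj] jn; first by rewrite subn0 grow0r shrink_end_col //; lia.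
  have := grow_cell A i j; rewrite (IHi j) ?(IHi j.+1) ?IHj; try by lia.
  have e1 : m - i = (m - i.+1).+1 by lia.
  have e2 : n - j = (n - j.+1).+1 by lia.
  rewrite e1 e2 => h; apply: (cell_fun r0 h).
  by apply: shrink_cell; lia.
exists A; split=> [j jn|i im]; rewrite key //.
  by rewrite subnn /=; congr P; lia.
by rewrite subnn shrink0r; congr Q; lia.
Qed.

End Shrink.
End Growth.

(** * The correspondence on matrices *)

Definition matrix_nat r (m n : nat) (A : 'M[{ffun 'I_r -> nat}]_(m, n)) (i j : nat) :
    {ffun 'I_r -> nat} :=
  if insub i is Some a then if insub j is Some b then A a b else [ffun=> 0]
  else [ffun=> 0].

Lemma matrix_natE r (m n : nat) (A : 'M[{ffun 'I_r -> nat}]_(m, n))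
    (i : 'I_m) (j : 'I_n) : matrix_nat A i j = A i j.
Proof. by rewrite /matrix_nat !valK. Qed.

Lemma matrix_nat_tr r (m n : nat) (A : 'M[{ffun 'I_r -> nat}]_(m, n)) :
  matrix_nat (A^T)%R = fun i j => matrix_nat A j i.
Proof.
apply: funext => i; apply: funext => j; rewrite /matrix_nat.
by case: insubP => [a _ _|_]; case: insubP => // b _ _; rewrite mxE.
Qed.

Definition rsk r g (m n : nat) (A : 'M[{ffun 'I_r -> nat}]_(m, n)) :
    n.+1.-tuple intpart * m.+1.-tuple intpart :=
  ([tuple grow g (matrix_nat A) m j | j < n.+1],
   [tuple grow g (matrix_nat A) i n | i < m.+1]).

Section Rsk.
Variables (r : nat) (r0 : 0 < r) (g : intpart) (m n : nat).
Implicit Type A : 'M[{ffun 'I_r -> nat}]_(m, n).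

Lemma before_rsk1 A j : before (rsk g A).1 j = grow g (matrix_nat A) m j.
Proof. by rewrite /before tnth_mktuple. Qed.

Lemma after_rsk1 A j : after (rsk g A).1 j = grow g (matrix_nat A) m j.+1.
Proof. by rewrite /after tnth_mktuple lift0. Qed.

Lemma before_rsk2 A i : before (rsk g A).2 i = grow g (matrix_nat A) i n.
Proof. by rewrite /before tnth_mktuple. Qed.

Lemma after_rsk2 A i : after (rsk g A).2 i = grow g (matrix_nat A) i.+1 n.
Proof. by rewrite /after tnth_mktuple lift0. Qed.

Lemma rsk_tableaux A : tableau_pairs r g m n (rsk g A).
Proof.
exists (grow g (matrix_nat A) m n); split.
- have : ribbon_le r g (grow g (matrix_nat A) m 0) by rewrite grow0r; exact: rt_refl.
  rewrite /RH /=; move: (matrix_nat A) => B; elim: n => [//|k IH] /IH h.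
  by apply: rt_trans h _; apply: strip_ribbon_le; have [] := grow_strips r0 g B m k.
- split=> [||j]; rewrite ?tnth_mktuple ?grow0r //.
  by rewrite before_rsk1 after_rsk1; have [] := grow_strips r0 g (matrix_nat A) m j.
- split=> [||i]; rewrite ?tnth_mktuple //.
  by rewrite before_rsk2 after_rsk2; have [] := grow_strips r0 g (matrix_nat A) i n.
Qed.

Lemma rsk_inj : injective (@rsk r g m n).
Proof.
move=> A B /pair_equal_spec [e1 e2]; apply/matrixP => i j.
rewrite -!matrix_natE; apply: (grow_inj r0 (g := g) (m := m) (n := n)) => //.
  move=> b bn; have := congr1 (fun t => tnth t (inord b)) e1.
  by rewrite !tnth_mktuple inordK.
move=> a am; have := congr1 (fun t => tnth t (inord a)) e2.
by rewrite !tnth_mktuple inordK.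
Qed.

Lemma rsk_onto PQ : core r g -> tableau_pairs r g m n PQ -> exists A, rsk g A = PQ.
Proof.
case: PQ => P Q hg [l [_ [/= P0 Pn hP] [/= Q0 Qm hQ]]].
have e0 (k : nat) : inord 0 = ord0 :> 'I_k.+1 by apply: val_inj; rewrite /= inordK.
have em (k : nat) : inord k = ord_max :> 'I_k.+1 by apply: val_inj; rewrite /= inordK.
have strips (k : nat) (T : k.+1.-tuple intpart) :
    (forall j, horizontal_strip r (before T j) (after T j)) ->
    forall j, j < k -> horizontal_strip r (tnth T (inord j)) (tnth T (inord j.+1)).
  move=> h j jk; have := h (Ordinal jk); rewrite /before /after.
  by congr horizontal_strip; congr tnth; apply: val_inj; rewrite /= inordK //; lia.
have [|||A [hrow hcol]] := @grow_onto r r0 g (fun j => tnth P (inord j))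
  (fun i => tnth Q (inord i)) m n _ _ _ (strips n P hP) (strips m Q hQ) hg.
- by rewrite !em Pn Qm.
- by rewrite e0.
- by rewrite e0.
exists (\matrix_(i, j) A i j)%R.
(* The finite matrix keeps the entries of [A] with [i < m] and [j < n], the only ones used up to the
   corner (m, n). *)
have key i j : i <= m -> j <= n ->
    grow g (matrix_nat (\matrix_(i < m, j < n) A i j)%R) i j = grow g A i j.
  elim: i j => [//|i IHi] j im; elim: j => [//|j IHj] jn /=.
  move: (IHi j (ltnW im) (ltnW jn)) (IHi j.+1 (ltnW im) jn) (IHj (ltnW jn)) => /= -> -> ->.
  congr insert; have := matrix_natE (\matrix_(i < m, j < n) A i j)%R (Ordinal im) (Ordinal jn).
  by rewrite mxE.
congr pair; apply: eq_from_tnth => i; rewrite tnth_mktuple key //.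
- by rewrite hrow ?inord_val // -ltnS.
- by rewrite -ltnS.
- by rewrite hcol ?inord_val // -ltnS.
- by rewrite -ltnS.
Qed.

End Rsk.

Theorem corollary5p2p8 (r : nat) (g : intpart) (hr : 0 < r) (hg : core r g) :
  exists f : forall m n : nat, 'M[{ffun 'I_r -> nat}]_(m, n) ->
               (n.+1.-tuple intpart * m.+1.-tuple intpart)%type,
    (forall m n : nat, set_bij setT (tableau_pairs r g m n) (f m n)) /\
    (forall (m n : nat) (A : 'M[{ffun 'I_r -> nat}]_(m, n))
            (P : n.+1.-tuple intpart) (Q : m.+1.-tuple intpart),
       f m n A = (P, Q) ->
       [/\ wt r P = [ffun j => \sum_(i < m) vsum (A i j)],
           wt r Q = [ffun i => \sum_(j < n) vsum (A i j)],
           (spin r P + spin r Q =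
              (\sum_(i < m) \sum_(j < n) vn (A i j))%N%:R)%R
         & f n m (A^T)%R = (Q, P)]).
Proof.
exists (@rsk r g); split=> [m n|m n A P Q e].
  split=> [A _|A B _ _|PQ hPQ]; first exact: rsk_tableaux.
    exact: rsk_inj.
  by have [A <-] := rsk_onto hr hg hPQ; exists A.
have [<- <-] : (rsk g A).1 = P /\ (rsk g A).2 = Q by rewrite e.
split.
- apply/ffunP => j; rewrite !ffunE before_rsk1 after_rsk1 grow_row_size //.
  by apply: eq_bigr => i _; rewrite matrix_natE.
- apply/ffunP => i; rewrite !ffunE before_rsk2 after_rsk2 grow_col_size //.
  by apply: eq_bigr => j _; rewrite matrix_natE.
- under [in RHS]eq_bigr => i _ do under eq_bigr => j _ do rewrite -matrix_natE.
  rewrite -(grow_spin hr g); congr (_ + _)%R; apply: eq_bigr => i _.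
    by rewrite before_rsk1 after_rsk1.
  by rewrite before_rsk2 after_rsk2.
congr pair; apply: eq_from_tnth => i; rewrite !tnth_mktuple matrix_nat_tr.
  exact: grow_tr.
exact: grow_tr.
Qed.
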